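(* Let $n\geq 3$ be an integer. Then: (1) There is an integer $q_0(n)$ such that, for every prime power $q\geq q_0(n)$, the number of distinct eigenvalues of $\Delta_0^{+}(\mathrm{Fl}_{n,q})$ is exactly $\left\lfloor \frac{n^2}{4}\right\rfloor+2$. (2) For every $\epsilon>0$ there is an integer $q_0(n,\epsilon)$ such that, for every prime power $q\geq q_0(n,\epsilon)$, every eigenvalue $\lambda\neq 0,n-1$ of $\Delta_0^{+}(\mathrm{Fl}_{n,q})$ satisfies $|\lambda-(n-2)|<\epsilon$.
   Context: A linear subspace of $\mathbb{F}_q^n$ is non-trivial if it is neither $\{0\}$ nor $\mathbb{F}_q^n$. A flag is a family of nested non-trivial subspaces $V_1\subsetneq\cdots\subsetneq V_k$; a complete flag is a flag of length $n-1$. $\mathrm{Fl}_{n,q}$ is the simplicial complex whose vertices are the non-trivial subspaces of $\mathbb{F}_q^n$ and whose simplices are the families of subspaces forming a flag. For a simplex $\sigma$, $w(\sigma)$ is the number of complete flags containing $\sigma$. $C^0(\mathrm{Fl}_{n,q})$ is the space of real functions on the vertices, and $C^1(\mathrm{Fl}_{n,q})$ the space of real skew-symmetric functions on ordered $1$-simplices. The coboundary operator $d_0:C^0\to C^1$ is $(d_0\phi)([U,V])=\phi(V)-\phi(U)$. For $k=0,1$ the space $C^k$ carries the inner product $\langle\phi,\psi\rangle=\sum_{\sigma} w(\sigma)\phi(\sigma)\psi(\sigma)$, summed over $k$-simplices $\sigma$ (each given one fixed order). $d_0^*$ is the adjoint of $d_0$ with respect to these inner products, and $\Delta_0^{+}(\mathrm{Fl}_{n,q})=d_0^*d_0: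 C^0\to C^0$ (the weighted upper $0$-Laplacian). *)

(* Defs.v *)
From HB Require Import structures.
From mathcomp Require Import all_boot all_order all_algebra.
From mathcomp Require Import reals.

Set Implicit Arguments.
Unset Strict Implicit.
Unset Printing Implicit Defensive.

Import Order.TTheory GRing.Theory Num.Theory.
Local Open Scope ring_scope.

HB.instance Definition _ (F : finFieldType) (vT : vectType F) :=
  CanIsCountable (@VectorInternalTheory.vs2mxK F vT).
HB.instance Definition _ (F : finFieldType) (vT : vectType F) :
    isFinite {vspace vT} :=
  CanIsFinite (@VectorInternalTheory.vs2mxK F vT).

Section FlagComplex.
Variables (F : finFieldType) (n : nat).

Definition nontrivial (U : {vspace 'rV[F]_n}) : bool :=
  (U != 0%VS) && (U != fullv).

Definition vertex : finType := {U : {vspace 'rV[F]_n} | nontrivial U}.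

(* A flag V_1 < ... < V_k is represented by its set of members, a chain of
   subspaces; its length k is the cardinality of that set. *)
Definition is_flag (s : {set vertex}) : bool :=
  [forall U in s, forall V in s,
     (val U <= val V)%VS || (val V <= val U)%VS].

Definition complete_flag (s : {set vertex}) : bool :=
  is_flag s && (#|s| == n.-1)%N.

Definition weight (s : {set vertex}) : nat :=
  #|[set t : {set vertex} | complete_flag t && (s \subset t)]|.

Definition is_edge (e : vertex * vertex) : bool :=
  (e.1 != e.2) && is_flag [set e.1; e.2].

Definition edge : finType := {e : vertex * vertex | is_edge e}.

Lemma is_edge_swap (e : vertex * vertex) : is_edge e -> is_edge (e.2, e.1).
Proof. by rewrite /is_edge /= eq_sym setUC. Qed.

Definition swap (e : edge) : edge :=
  exist _ ((val e).2, (val e).1) (is_edge_swap (valP e)).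

Lemma swapK : involutive swap.
Proof. by case=> [[U V] UV]; apply: val_inj. Qed.

Definition tail (e : edge) : vertex := (val e).1.
Definition head (e : edge) : vertex := (val e).2.

Lemma weight_vertex_gt0 (V : vertex) : (0 < weight [set V])%N.
Proof.
case: V => V VP.
have /andP[V0 V1] := VP.
pose X := vbasis V ++ vbasis (V^C).
have fX : basis_of (V + V^C)%VS X.
  apply: cat_basis; rewrite ?vbasisP //.
  by apply/directv_addP; apply: capv_compl.
have dimfull : \dim (fullv : {vspace 'rV[F]_n}) = n.
  by rewrite dimvf /dim /= mul1n.
have freeX := basis_free fX.
have spanX : <<X>>%VS = fullv by rewrite (span_basis fX) addv_complf.
have sizeX : size X = n.
  by move/eqP: freeX; rewrite spanX dimfull.
pose W i : {vspace 'rV[F]_n} := <<take i X>>%VS.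
have dimW i : (i <= n)%N -> \dim (W i) = i.
  move=> le_in; have : free (take i X).
    by move: freeX; rewrite -{1}(cat_take_drop i X) => /catl_free.
  by move/eqP->; rewrite size_takel ?sizeX.
have WP (i : 'I_n.-1) : nontrivial (W i.+1).
  have lt_in : (i.+1 < n)%N by case: (n) i => [|m] [i].
  rewrite /nontrivial -dimv_eq0 dimW 1?ltnW //=; apply/eqP => E.
  have := dimW _ (ltnW lt_in); rewrite E dimfull => E'.
  by rewrite -E' ltnn in lt_in.
have W_mono i j : (i <= j)%N -> (W i <= W j)%VS.
  move=> le_ij; apply: sub_span => x.
  by rewrite -(subnKC le_ij) takeD mem_cat => ->.
pose w (i : 'I_n.-1) : vertex := Sub (W i.+1) (WP i).
rewrite card_gt0; apply/set0Pn; exists [set w i | i in 'I_n.-1].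
rewrite inE; apply/andP; split; last first.
  have dV0 : (0 < \dim V)%N by rewrite lt0n dimv_eq0.
  have dVn : (\dim V < n)%N.
    have : (\dim V < \dim (fullv : {vspace 'rV[F]_n}))%N.
      rewrite ltn_neqAle (dimvS (subvf V)) andbT.
      by apply: contra V1 => /eqP E; rewrite eqEdim subvf E leqnn.
    by rewrite dimfull.
  have lt_d : ((\dim V).-1 < n.-1)%N by case: (\dim V) dV0 dVn => // d _; case: (n).
  rewrite sub1set; apply/imsetP; exists (Ordinal lt_d) => //.
  apply: val_inj; rewrite /= prednK // /W /X take_size_cat ?size_tuple //.
  by rewrite (span_basis (vbasisP V)).
rewrite /complete_flag; apply/andP; split.
  apply/forall_inP => _ /imsetP[i _ ->]; apply/forall_inP => _ /imsetP[j _ ->].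
  by case/orP: (leq_total i j) => ij; apply/orP; [left|right]; apply: W_mono.
rewrite card_imset ?card_ord // => i j /(congr1 (fun u => \dim (val u))) /=.
have le k : (k < n.-1)%N -> (k.+1 <= n)%N by case: (n) => // m; apply: leqW.
by rewrite !dimW ?le // => -[] /val_inj.
Qed.

Variable R : realType.

Definition C0 := {ffun vertex -> R^o}.

Definition skew_symmetric : {pred {ffun edge -> R^o}} :=
  fun psi => [forall e, psi (swap e) == - psi e].

Lemma skew_submod_closed : submod_closed skew_symmetric.
Proof.
split=> [|a f g /forallP fP /forallP gP]; apply/forallP => e.
  by rewrite !ffunE oppr0.
by rewrite !ffunE (eqP (fP e)) (eqP (gP e)) scalerN opprD.
Qed.

HB.instance Definition _ :=
  GRing.isSubmodClosed.Build R {ffun edge -> R^o} skew_symmetric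
    skew_submod_closed.

Record C1 := MkC1 { cochain1 :> {ffun edge -> R^o};
                    _ : cochain1 \in skew_symmetric }.
HB.instance Definition _ := [isSub for cochain1].
HB.instance Definition _ := [Choice of C1 by <:].
HB.instance Definition _ := [SubChoice_isSubLmodule of C1 by <:].

Definition inner0 (phi psi : C0) : R :=
  \sum_(V : vertex) (weight [set V])%:R * phi V * psi V.

(* The fixed order chosen on a 1-simplex puts the smaller subspace first. *)
Definition inner1 (phi psi : C1) : R :=
  \sum_(e : edge | (val (tail e) <= val (head e))%VS)
     (weight [set tail e; head e])%:R * phi e * psi e.

Definition d0_fun (phi : C0) : {ffun edge -> R^o} :=
  [ffun e => phi (head e) - phi (tail e)].

Lemma d0_skew phi : d0_fun phi \in skew_symmetric.
Proof. by apply/forallP => e; rewrite !ffunE opprB. Qed.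

Definition d0 (phi : C0) : C1 := MkC1 (d0_skew phi).

Lemma d0_is_linear : linear d0.
Proof.
move=> a f g; apply: val_inj; apply/ffunP => e.
by rewrite !ffunE scalerBr opprD addrACA.
Qed.

HB.instance Definition _ := GRing.isLinear.Build R C0 C1 _ d0 d0_is_linear.

Definition delta (V : vertex) : C0 := [ffun U => (U == V)%:R].

Lemma deltaE V U : delta V U = (U == V)%:R :> R.
Proof. by rewrite ffunE. Qed.

(* The value at V of an adjoint is forced by pairing with delta V. That this
   formula does give the adjoint, and the only one, is d0_adjP and
   d0_adj_unique. *)
Definition d0_adj (psi : C1) : C0 :=
  [ffun V => inner1 (d0 (delta V)) psi / (weight [set V])%:R].

Lemma inner1_linearl psi : linear ((inner1^~ psi) : C1 -> R^o).
Proof.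
move=> a f g; rewrite /inner1 scaler_sumr -big_split /=.
apply: eq_bigr => e _; rewrite !ffunE /=.
by rewrite mulrDr mulrDl /GRing.scale /= !mulrA [_ * a]mulrC.
Qed.

Lemma inner1_linearr phi : linear (inner1 phi : C1 -> R^o).
Proof.
move=> a f g; rewrite /inner1 scaler_sumr -big_split /=.
apply: eq_bigr => e _; rewrite !ffunE /=.
by rewrite mulrDr /GRing.scale /= [a * (_ * _)]mulrCA.
Qed.

Lemma weight_vertex_neq0 (V : vertex) : (weight [set V])%:R != 0 :> R.
Proof. by rewrite pnatr_eq0 -lt0n weight_vertex_gt0. Qed.

Lemma inner0_delta V (psi : C0) :
  inner0 (delta V) psi = (weight [set V])%:R * psi V.
Proof.
rewrite /inner0 (bigD1 V) //= ffunE eqxx mulr1 big1 ?addr0 // => U UV.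
by rewrite ffunE (negPf UV) mulr0 mul0r.
Qed.

Lemma sum_deltaE (a : vertex -> R) (U : vertex) :
  \sum_V a V * delta V U = a U.
Proof.
under eq_bigr do rewrite deltaE.
rewrite (bigD1 U) //= eqxx mulr1 big1 ?addr0 // => V VU.
by rewrite eq_sym (negPf VU) mulr0.
Qed.

Lemma d0_adjP (phi : C0) (psi : C1) :
  inner1 (d0 phi) psi = inner0 phi (d0_adj psi).
Proof.
transitivity (\sum_V phi V * inner1 (d0 (delta V)) psi).
  rewrite /inner1; under [RHS]eq_bigr do rewrite mulr_sumr.
  rewrite exchange_big /=; apply: eq_bigr => e _.
  under eq_bigr do rewrite mulrA mulrCA.
  rewrite -mulr_suml -mulr_sumr; congr (_ * _ * _).
  under eq_bigr do rewrite ffunE mulrBr.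
  by rewrite sumrB !sum_deltaE ffunE.
apply: eq_bigr => V _; rewrite [d0_adj _ _]ffunE.
rewrite [_ * phi V]mulrC -mulrA; congr (_ * _).
by rewrite [RHS]mulrC divfK ?weight_vertex_neq0.
Qed.

Lemma d0_adj_unique (dstar : C1 -> C0) :
  (forall phi psi, inner1 (d0 phi) psi = inner0 phi (dstar psi)) ->
  dstar =1 d0_adj.
Proof.
move=> adj psi; apply/ffunP => V; rewrite ffunE adj inner0_delta.
by rewrite mulrC mulKf ?weight_vertex_neq0.
Qed.

Lemma d0_adj_is_linear : linear d0_adj.
Proof.
move=> a f g; apply/ffunP => V; rewrite !ffunE inner1_linearr.
by rewrite mulrDl /GRing.scale /= mulrA.
Qed.

HB.instance Definition _ :=
  GRing.isLinear.Build R C1 C0 _ d0_adj d0_adj_is_linear.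

Definition Laplacian0 : 'End(C0) := linfun (d0_adj \o d0).

Lemma Laplacian0E phi : Laplacian0 phi = d0_adj (d0 phi).
Proof. by rewrite lfunE. Qed.

End FlagComplex.

(* Main.v *)
From HB Require Import structures.
Require Import Defs.
From mathcomp Require Import all_boot all_order all_algebra.
From mathcomp Require Import finfield.
From mathcomp Require Import reals ring lra zify.

Set Implicit Arguments.
Unset Strict Implicit.
Unset Printing Implicit Defensive.

Import Order.TTheory GRing.Theory Num.Theory.
Local Open Scope ring_scope.

(** The Laplacian commutes with GL(n, q), and on functions on subspaces of
    dimension i the representation of GL(n, q) is the multiplicity-free sum
    of the unipotent representations attached to the partitions (n-k, k), for
    k <= min(i, n-i).  The proof carries out this decomposition by hand, with
    the operators U (sum over the lower covers of a subspace) and D (sum over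
    the upper covers) on functions on all subspaces.  They satisfy
    D U - U D = [n-d] - [d] in dimension d (Down_Up), where [m] is the
    q-analogue of m, exactly as the raising and lowering operators of sl_2
    do.  A function s in dimension k killed by D therefore generates a string
    s, U s, U^2 s, ... which stops in dimension n-k and on which D acts by
    explicit scalars (string_Down, string_high); the strings span all
    functions, because the kernel of D is the orthogonal complement of the
    image of U (strings_span), and strings starting in dimension k exist
    whenever 2k <= n (string_exists).

    A complete flag has one member in each dimension, and GL(n, q) is
    transitive on pairs of nested subspaces of given dimensions.  Hence the
    Laplacian is n-1 minus the sum of the averages over the incident
    subspaces of each dimension, V being the only one of its own dimension
    incident to V (Laplacian_formula).  Averages over smaller,
    respectively larger, subspaces satisfy a one-step recursion through U,
    respectively D, so the Laplacian preserves each string.  On a string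
    that starts in dimension k >= 1 it is an explicit matrix of size
    N = n+1-2k whose inverse, after a shift, is tridiagonal: its eigenvalues
    are n-1-1/(1-w), where w runs over the roots of a Jacobi polynomial of
    degree N (root_eigenvalue, eigenvalue_root).  A Jacobi polynomial with
    positive off-diagonal products has only simple real roots
    (jac_real_roots).  The
    constants (k = 0) contribute the eigenvalues 0 and n-1.  The sum of the
    sizes n+1-2k for 1 <= k <= n/2 is the integer part of n^2/4, so that
    (1) amounts to the absence of coincidences between different blocks,
    when q is large.

    For this, put s = 1/sqrt q.  The roots of block k have order s^k
    (root_size), so the eigenvalues n-1-1/(1-w) tend to n-2, which proves
    (2).  After division by s^k they tend to the roots of a Chebyshev
    polynomial of degree N; these are not 0, except for a simple root 0 when
    N is odd.  A common root of blocks k < k' is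
    O(s^k'), hence is that exceptional root for block k.  A second-order
    expansion places it at -2r/(r+1) s^(2k), with N = 2r+1
    (small_root_odd).  If k' < 2k or k' > 2k the orders of magnitude do not
    match; if k' = 2k, the rational number -2r/(r+1) would be a root of a
    Chebyshev polynomial, a monic polynomial with integer coefficients, which
    is impossible (cheb_neq0); when r = 1 that polynomial is X. *)

(** * Jacobi polynomials and their real roots *)

Section JacobiPolynomials.
Variable R : rcfType.
Implicit Types (a c : nat -> R) (y : R).

(** The determinant p_j of X + A, for A tridiagonal of size j with diagonal
    entries a and with products c of opposite off-diagonal entries. *)
Fixpoint jac a c j : {poly R} :=
  if j is i.+1 then
    ('X + (a i)%:P) * jac a c i
      - (c i)%:P * (if i is h.+1 then jac a c h else 0)
  else 1.

Lemma jacS a c i :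
  jac a c i.+1 = ('X + (a i)%:P) * jac a c i - (c i)%:P * (if i is h.+1 then jac a c h else 0).
Proof. by []. Qed.

Lemma jac1 a c : jac a c 1 = 'X + (a 0%N)%:P.
Proof. by rewrite jacS /= mulr1 mulr0 subr0. Qed.

Lemma jacSS a c j :
  jac a c j.+2 =
  ('X + (a j.+1)%:P) * jac a c j.+1 - (c j.+1)%:P * jac a c j.
Proof. by []. Qed.

Lemma horner_jac1 a c y : (jac a c 1).[y] = y + a 0%N.
Proof. by rewrite jac1 !hornerE. Qed.

Lemma horner_jacSS a c j y :
  (jac a c j.+2).[y] =
  (y + a j.+1) * (jac a c j.+1).[y] - c j.+1 * (jac a c j).[y].
Proof. by rewrite jacSS !hornerE. Qed.

Lemma horner_jac_root a c j y : (0 < j)%N -> root (jac a c j) y ->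
  (jac a c j.+1).[y] = - c j * (jac a c j.-1).[y].
Proof.
by case: j => // j _ /eqP ry; rewrite horner_jacSS ry mulr0 sub0r mulNr.
Qed.

Lemma jac_ind2 (P : nat -> Prop) :
  P 0%N -> P 1%N -> (forall j, P j -> P j.+1 -> P j.+2) -> forall j, P j.
Proof.
move=> P0 P1 PS j; suff [] : P j /\ P j.+1 by [].
by elim: j => [|j [IH1 IH2]]; split=> //; apply: PS.
Qed.

Lemma jac_monic_size a c j : (jac a c j \is monic) /\ size (jac a c j) = j.+1.
Proof.
elim/jac_ind2: j => [||j [m0 s0] [m1 s1]].
- by rewrite /= monic1 size_poly1.
- by rewrite jac1 monicXaddC size_XaddC.
have mX : 'X + (a j.+1)%:P \is monic by apply: monicXaddC.
have mP := monicMl _ mX; have sX := size_XaddC (a j.+1).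
have sP : size (('X + (a j.+1)%:P) * jac a c j.+1) = j.+3.
  by rewrite size_Mmonic ?monic_neq0 // sX s1.
have sQ : (size (- ((c j.+1)%:P * jac a c j)) < j.+3)%N.
  rewrite size_polyN mul_polyC; apply: leq_ltn_trans (size_scale_leq _ _) _.
  by rewrite s0.
rewrite jacSS size_polyDl ?sP //; split=> //.
by rewrite monicE lead_coefDl ?sP // -monicE monicMl.
Qed.

Lemma size_jac a c j : size (jac a c j) = j.+1.
Proof. by case: (jac_monic_size a c j). Qed.

Lemma jac_monic a c j : jac a c j \is monic.
Proof. by case: (jac_monic_size a c j). Qed.

Lemma jac_scale a c t y j :
  (jac (fun i => t * a i) (fun i => t ^+ 2 * c i) j).[t * y] =
  t ^+ j * (jac a c j).[y].
Proof.
elim/jac_ind2: j => [||j IH0 IH1]; first by rewrite /= !hornerE.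
  by rewrite !horner_jac1; ring.
by rewrite !horner_jacSS IH0 IH1 !exprS; ring.
Qed.

Lemma jac_opp a c y j :
  (jac a c j).[- y] = (-1) ^+ j * (jac (fun i => - a i) c j).[y].
Proof.
elim/jac_ind2: j => [||j IH0 IH1]; first by rewrite /= !hornerE.
  by rewrite !horner_jac1; ring.
by rewrite !horner_jacSS IH0 IH1 !exprS; ring.
Qed.

Lemma eq_jac a a' c c' j : (forall i, (i < j)%N -> a i = a' i) ->
  (forall i, (0 < i < j)%N -> c i = c' i) -> jac a c j = jac a' c' j.
Proof.
elim/jac_ind2: j => [||j IH0 IH1] ea ec; first by [].
  by rewrite !jac1 ea.
rewrite 2!jacSS IH0 ?IH1 ?ea ?ec ?leqnn // => i.
- by move=> ij; apply: ea; rewrite ltnW.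
- by case/andP=> i0 ij; apply: ec; rewrite i0 ltnW.
- by move=> ij; apply: ea; rewrite ltnW // ltnW.
- by case/andP=> i0 ij; apply: ec; rewrite i0 ltnW // ltnW.
Qed.

End JacobiPolynomials.

Section JacobiBounds.
Variables (R : rcfType) (a c : nat -> R) (A C : R) (N : nat).
Hypothesis C_ge0 : 0 <= C.
Hypothesis a_le : forall j, (j < N)%N -> `|a j| <= A.
Hypothesis c_le : forall j, (0 < j < N)%N -> `|c j| <= C.

(** Far to the right of the coefficients the factor y + a_j dominates c_j,
    so the values increase with the degree; this bounds all the roots. *)
Lemma jac_incr (y : R) j : A + C + 1 <= y -> (j < N)%N ->
  0 < (jac a c j).[y] <= (jac a c j.+1).[y].
Proof.
have C0 := C_ge0; move=> le_y; elim: j => [|j IH] ltj.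
  have := a_le ltj; rewrite ler_norml => /andP[a1 a2].
  by rewrite horner_jac1 /= hornerE ltr01 /=; lra.
have /andP[f0 f1] := IH (ltnW ltj).
have := a_le ltj; rewrite ler_norml => /andP[a1 a2].
have := @c_le j.+1; rewrite ltj => /(_ isT); rewrite ler_norml => /andP[c1 c2].
rewrite horner_jacSS; apply/andP; split; first lra.
have h1 : (C + 1) * (jac a c j.+1).[y] <= (y + a j.+1) * (jac a c j.+1).[y].
  by apply: ler_wpM2r; lra.
have h2 : c j.+1 * (jac a c j).[y] <= C * (jac a c j.+1).[y].
  by apply: le_trans (ler_wpM2r (ltW f0) c2) _; apply: ler_wpM2l.
lra.
Qed.

Lemma jac_gt0 (y : R) j : A + C + 1 <= y -> (j <= N)%N -> 0 < (jac a c j).[y].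
Proof.
case: j => [|j] le_y lej; first by rewrite /= hornerE ltr01.
have /andP[f0 f1] := jac_incr le_y lej; exact: lt_le_trans f1.
Qed.

End JacobiBounds.

Section JacobiRoots.
Variable R : rcfType.
Implicit Types (a c : nat -> R) (N : nat) (y z A C : R).

Lemma jac_sign_neg a c A C N y : 0 <= C ->
  (forall j, (j < N)%N -> `|a j| <= A) ->
  (forall j, (0 < j < N)%N -> `|c j| <= C) ->
  A + C + 1 <= y -> forall j, (j <= N)%N -> 0 < (-1) ^+ j * (jac a c j).[- y].
Proof.
move=> C0 ha hc hy j jN; rewrite jac_opp mulrA -exprMn mulrNN mulr1 expr1n mul1r.
apply: (jac_gt0 C0 _ hc hy jN) => i iN; rewrite normrN; exact: ha.
Qed.

Lemma jac_root_bound a c A C N y : 0 <= C ->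
  (forall j, (j < N)%N -> `|a j| <= A) ->
  (forall j, (0 < j < N)%N -> `|c j| <= C) ->
  root (jac a c N) y -> `|y| <= A + C + 1.
Proof.
move=> C0 ha hc /eqP ry; rewrite ler_norml; apply/andP; split.
  rewrite leNgt; apply/negP => ly.
  have ly' : A + C + 1 <= - y by lra.
  have := jac_sign_neg C0 ha hc ly' (leqnn N).
  by rewrite opprK ry mulr0 ltxx.
rewrite leNgt; apply/negP => /ltW ly.
by have := jac_gt0 C0 ha hc ly (leqnn N); rewrite ry ltxx.
Qed.

Lemma alternating_roots (p : {poly R}) (x : nat -> R) m :
  (forall i, (i < m)%N -> x i < x i.+1) ->
  (forall i, (i <= m)%N -> 0 < (-1) ^+ (m - i) * p.[x i]) ->
  exists r : nat -> R, forall i, (i < m)%N -> x i < r i < x i.+1 /\ root p (r i).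
Proof.
move=> x_incr x_alt.
have ex (i : 'I_m) : exists r : R, x i < r < x i.+1 /\ root p r.
  have im := ltn_ord i; set e : R := (-1) ^+ (m - i.+1).
  have s1 := x_alt _ (ltnW im); have s2 := x_alt _ im.
  have e1 : (-1) ^+ (m - i) = - e by rewrite /e -subSS subSn // exprS mulN1r.
  rewrite e1 in s1; rewrite -/e in s2.
  have [] := @poly_ivt R (e *: p) (x i) (x i.+1); first exact/ltW/x_incr.
    by rewrite !hornerZ; apply/andP; split; lra.
  move=> r /andP[r1 r2]; rewrite rootZ; last by rewrite signr_eq0.
  move=> rr; exists r; split=> //.
  by rewrite !lt_neqAle r1 r2 !andbT; apply/andP; split; apply/eqP => E;
    move/eqP: rr s1 s2; rewrite -?E ?E => ->; rewrite !mulr0 ltxx.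
have [f fP] := fin_all_exists ex.
by exists (fun i => oapp f 0 (insub i)) => i im; rewrite insubT /=; exact: (fP (Ordinal im)).
Qed.

Lemma lt_of_consecutive (r : nat -> R) m :
  (forall i, (i.+1 < m)%N -> r i < r i.+1) ->
  forall i j, (i < j < m)%N -> r i < r j.
Proof.
move=> inc i j; elim: j => [|j IH] /andP[]; first by rewrite ltn0.
rewrite ltnS leq_eqVlt => /orP[/eqP->|ij] jm; first exact: inc.
by apply: lt_trans (inc _ jm); apply: IH; rewrite ij ltnW.
Qed.

(** The factors at the roots below z are positive and the j - i others are
    negative. *)
Lemma sign_prod_roots (r : nat -> R) j i z : (i <= j)%N ->
  (forall l, (l < i)%N -> r l < z) ->
  (forall l, (i <= l < j)%N -> z < r l) ->
  0 < (-1) ^+ (j - i) * (\prod_(t <- mkseq r j) ('X - t%:P)).[z].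
Proof.
move=> ij lo hi; rewrite horner_prod big_map -/(iota _ _).
have -> : iota 0 j = iota 0 i ++ iota i (j - i) by rewrite -{1}(subnKC ij) iotaD.
rewrite big_cat /= mulrCA; apply: mulr_gt0.
  rewrite big_seq; apply: prodr_gt0 => l; rewrite mem_iota add0n => /andP[_ li].
  by rewrite !hornerE subr_gt0 lo.
have -> : (-1) ^+ (j - i) = \prod_(l <- iota i (j - i)) (-1 : R).
  by rewrite big_const_seq count_predT size_iota iter_mulr_1.
rewrite -big_split big_seq; apply: prodr_gt0 => l.
rewrite mem_iota subnKC // => h; rewrite !hornerE /=; have := hi _ h; lra.
Qed.

(** Roots of consecutive Jacobi polynomials interlace: at a root of p_j the
    recurrence gives p_(j+1) = - c_j p_(j-1), and p_(j-1) alternates in sign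
    along the roots of p_j, so p_(j+1) changes sign between any two of them
    and on either side. *)
Lemma jac_real_roots a c N : (forall j, (0 < j < N)%N -> 0 < c j) ->
  exists r : seq R, [/\ uniq r, size r = N & forall y, root (jac a c N) y = (y \in r)].
Proof.
move=> c_gt0.
suff [r [r_incr rE _]] : exists r : nat -> R,
    [/\ forall i, (i.+1 < N)%N -> r i < r i.+1,
        jac a c N = \prod_(t <- mkseq r N) ('X - t%:P)
      & forall i, (i < N)%N -> 0 < (-1) ^+ (N.-1 - i) * (jac a c N.-1).[r i]].
  exists (mkseq r N); split; last by move=> y; rewrite rE root_prod_XsubC.
    rewrite map_inj_in_uniq ?iota_uniq // => i j.
    rewrite !mem_iota !add0n /= => iN jN E; apply/eqP; rewrite eqn_leq.
    have lt := lt_of_consecutive r_incr.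
    by apply/andP; split; rewrite leqNgt; apply/negP => h;
      [have := lt j i | have := lt i j]; rewrite h ?iN ?jN E ltxx => /(_ isT).
  by rewrite size_mkseq.
have bnd (f : nat -> R) : exists2 B, 0 <= B & forall j, (j < N.+1)%N -> `|f j| <= B.
  exists (\sum_(i < N.+1) `|f i|); first exact: sumr_ge0.
  by move=> j jN; rewrite (bigD1 (Ordinal jN)) //= lerDl sumr_ge0.
have [A A0 hA] := bnd a; have [C C0 hC] := bnd c.
(* Induction on the degree j; the range N of the hypothesis on c is fixed. *)
have: (N <= N)%N by []; elim: {1 3 4 5 6 7 8}N => [|j IH] jN.
  by exists (fun _ => 0); split => //; rewrite big_nil.
have [r [r_incr rE rs]] := IH (ltnW jN).
have [B0 B0_ge0 hB0] := bnd r.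
pose B := B0 + A + C + 1.
have r_lt l : (l < j)%N -> - B < r l < B.
  move=> lj; have := hB0 l (ltnW (leq_trans lj (ltnW jN))).
  by rewrite ler_norml /B => /andP[? ?]; apply/andP; split; lra.
(* The j roots of p_j, framed by two points beyond all the roots. *)
pose x i := if i is l.+1 then (if (l < j)%N then r l else B) else - B.
have x_incr i : (i < j.+1)%N -> x i < x i.+1.
  case: i => [|i] ij /=.
    case: ifP => [/r_lt/andP[]//|_]; rewrite /B; lra.
  rewrite -ltnS ij; case: ifP => h; first exact: r_incr.
  by case/andP: (r_lt i ij).
have x_alt i : (i <= j.+1)%N -> 0 < (-1) ^+ (j.+1 - i) * (jac a c j.+1).[x i].
  have ha l : (l < N)%N -> `|a l| <= A by move=> lN; apply: hA; apply: ltnW.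
  have hc l : (0 < l < N)%N -> `|c l| <= C.
    by case/andP=> _ lN; apply: hC; apply: ltnW.
  have hy : A + C + 1 <= B by rewrite /B; lra.
  case: i => [|i] ij /=; first by rewrite subn0; apply: jac_sign_neg hy _ jN.
  case: ifP => h.
    have rr : root (jac a c j) (r i).
      by rewrite rE root_prod_XsubC; apply/mapP; exists i; rewrite ?mem_iota.
    have j0 : (0 < j)%N by apply: leq_ltn_trans h.
    rewrite (horner_jac_root j0 rr).
    have ci : 0 < c j by apply: c_gt0; rewrite j0.
    have := mulr_gt0 ci (rs _ h); rewrite subSS.
    have -> : (j - i = (j.-1 - i).+1)%N by lia.
    rewrite exprS; set u := (-1) ^+ _; set v := _.[_]; lra.
  have -> : i = j by apply/eqP; rewrite eqn_leq -ltnS ij leqNgt h.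
  by rewrite subnn expr0 mul1r; exact: (jac_gt0 C0 ha hc hy jN).
have [r' r'P] := alternating_roots x_incr x_alt.
exists r'; split.
- move=> i ij; have [/andP[_ h1] _] := r'P _ (ltnW ij).
  by have [/andP[h2 _] _] := r'P _ ij; apply: lt_trans h1 h2.
- have incr' := lt_of_consecutive (r := r') (m := j.+1).
  have {}incr' : forall i i', (i < i' < j.+1)%N -> r' i < r' i'.
    apply: incr' => i ij; have [/andP[_ h1] _] := r'P _ (ltnW ij).
    by have [/andP[h2 _] _] := r'P _ ij; apply: lt_trans h1 h2.
  rewrite [LHS](@all_roots_prod_XsubC _ _ (mkseq r' j.+1)).
  + by rewrite (monicP (jac_monic a c j.+1)) scale1r.
  + by rewrite size_jac size_mkseq.
  + apply/allP => t /mapP[i]; rewrite mem_iota => /andP[_ ij] ->.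
    by case: (r'P i ij).
  rewrite uniq_rootsE map_inj_in_uniq ?iota_uniq // => i i'.
  rewrite !mem_iota !add0n /= => iN jN' E; apply/eqP; rewrite eqn_leq.
  by apply/andP; split; rewrite leqNgt; apply/negP => h;
      [have := incr' i' i | have := incr' i i']; rewrite h ?iN ?jN' E ltxx => /(_ isT).
- move=> i ij /=; have [/andP[h1 h2] _] := r'P _ ij.
  rewrite rE; apply: sign_prod_roots => // l hl.
    apply: le_lt_trans h1; case: i ij hl {h2} => // i ij; rewrite ltnS => li.
    rewrite /= -ltnS ij; move: li; rewrite leq_eqVlt => /orP[/eqP->//|li].
    by apply/ltW/(lt_of_consecutive r_incr); rewrite li -ltnS.
  case/andP: hl => il lj; apply: lt_le_trans h2 _.
  rewrite /= (leq_ltn_trans il lj); move: il; rewrite leq_eqVlt => /orP[/eqP->//|li].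
  by apply/ltW/(lt_of_consecutive r_incr); rewrite li.
Qed.

End JacobiRoots.

(** * The eigenvalue system of a semiseparable matrix *)

Section BlockSystem.
Variables (R : rcfType) (N : nat) (eta al be : nat -> R).
Hypothesis al0 : al 0%N = 0.
Hypothesis beN : be N = 0.
Hypothesis albe : forall j, (j <= N)%N -> al j * be j * eta j = eta j - 1.
Hypothesis eta_neq0 : forall j, (0 < j < N)%N -> eta j != 0.
Hypothesis be_neq0 : forall j, (0 < j < N)%N -> be j != 0.

(** The equation M x = mu x for the matrix M with entry 1 on the diagonal,
    al_(j+1) ... al_i at (i, j) below it and be_(i+1) ... be_j at (i, j)
    above it.  The vectors y and z are the contributions of the two
    triangular parts, which obey one-step recursions.  The conventions
    al_0 = 0 and be_N = 0 make the recursions valid at both ends, where j.-1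
    and j.+1 leave the range. *)
Definition block_system (mu : R) (x y z : nat -> R) :=
  forall j, (j < N)%N ->
    [/\ y j = al j * (y j.-1 + x j.-1),
        z j = be j.+1 * (x j.+1 + z j.+1)
      & y j + x j + z j = mu * x j].

(** The matrix depends, up to diagonal conjugation, on the products
    al_j be_j = 1 - 1/eta_j only. *)
Definition block_poly : {poly R} :=
  jac (fun j => eta j + eta j.+1 - 2) (fun j => eta j * (eta j - 1)) N.

Let F j (w : R) :=
  (jac (fun j => eta j + eta j.+1 - 2) (fun j => eta j * (eta j - 1)) j).[w].

(** The diagonal conjugation that makes the three-term recurrence monic. *)
Let gauge j := \prod_(i < j) (eta i.+1 * be i.+1).

Let gaugeS j : gauge j.+1 = gauge j * (eta j.+1 * be j.+1).
Proof. by rewrite /gauge big_ord_recr. Qed.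

Let gauge_neq0 j : (j < N)%N -> gauge j != 0.
Proof.
move=> jN; apply/prodf_neq0 => i _; have iN := leq_ltn_trans (ltn_ord i) jN.
by rewrite mulf_neq0 ?eta_neq0 ?be_neq0.
Qed.

Let gaugeN : (0 < N)%N -> gauge N = 0.
Proof. by case: N beN => // n b _; rewrite gaugeS b !mulr0. Qed.

Let eta0 : eta 0 = 1.
Proof. by have := albe (leq0n N); rewrite al0 !mul0r; lra. Qed.

Let etaN : eta N = 1.
Proof. by have := albe (leqnn N); rewrite beN mulr0 mul0r; lra. Qed.

Let three_term (w : R) (x : nat -> R) j :=
  eta j.+1 * be j.+1 * x j.+1 =
  (w + (eta j + eta j.+1 - 2)) * x j - eta j * al j * x j.-1.

(** The inverse of M is tridiagonal: eliminating y and z between consecutive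
    equations leaves a relation between x_(j-1), x_j and x_(j+1), in which
    mu enters through w = 1 - 1/mu. *)
Lemma block_system_three_term mu x y z j : mu != 0 ->
  block_system mu x y z -> (j < N)%N -> three_term (1 - mu^-1) x j.
Proof.
move=> mu0 sys jN; have [yj zj ej] := sys _ jN.
have H1 : eta j * mu * (x j - al j * x j.-1) = x j + z j.
  case: j jN yj zj ej => [|i] iN yj zj ej.
    by rewrite al0 eta0 /=; rewrite al0 mul0r in yj; lra.
  have [_ zi ei] := sys _ (ltnW iN); have ab := albe (ltnW iN).
  rewrite /= in yj *.
  have -> : eta i.+1 * mu * (x i.+1 - al i.+1 * x i)
    = eta i.+1 * (mu * x i.+1) - eta i.+1 * al i.+1 * (mu * x i) by ring.
  rewrite -ei -ej yj zi.
  set t := x i.+1 + z i.+1.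
  have -> : eta i.+1 * (al i.+1 * (y i + x i) + x i.+1 + z i.+1) -
    eta i.+1 * al i.+1 * (y i + x i + be i.+1 * t) =
    t + ((eta i.+1 - 1) - al i.+1 * be i.+1 * eta i.+1) * t by rewrite /t; ring.
  by rewrite ab subrr mul0r addr0.
have H2 : eta j.+1 * mu * (x j - be j.+1 * x j.+1) = y j + x j.
  move: jN; rewrite leq_eqVlt => /orP[/eqP E|jN].
    by rewrite E beN etaN; rewrite E beN mul0r in zj; lra.
  have [yi _ ei] := sys _ jN; have ab := albe (ltnW jN).
  rewrite /= in yi *.
  have -> : eta j.+1 * mu * (x j - be j.+1 * x j.+1)
    = eta j.+1 * (mu * x j) - eta j.+1 * be j.+1 * (mu * x j.+1) by ring.
  rewrite -ei -ej yi zj.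
  set t := y j + x j.
  have -> : eta j.+1 * (t + be j.+1 * (x j.+1 + z j.+1)) -
    eta j.+1 * be j.+1 * (al j.+1 * t + x j.+1 + z j.+1) =
    t + ((eta j.+1 - 1) - al j.+1 * be j.+1 * eta j.+1) * t by ring.
  by rewrite ab subrr mul0r addr0.
apply: (mulfI mu0); rewrite /three_term.
have -> : mu * ((1 - mu^-1 + (eta j + eta j.+1 - 2)) * x j - eta j * al j * x j.-1)
   = (mu * (eta j + eta j.+1 - 1) - 1) * x j - mu * eta j * al j * x j.-1.
  by field.
move: H1 H2; lra.
Qed.

Lemma block_system_root mu x y z : mu != 0 -> block_system mu x y z ->
  ~~ root block_poly (1 - mu^-1) -> forall j, (j < N)%N -> x j = 0.
Proof.
move=> mu0 sys nroot; set w := 1 - mu^-1 in nroot.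
have claim j : (j <= N)%N -> gauge j * x j = x 0%N * F j w.
  elim/jac_ind2: j => [_||j IH0 IH1].
  - by rewrite /gauge big_ord0 /F /= !hornerE ?mul1r ?mulr1.
  - move=> N1; have := block_system_three_term mu0 sys N1.
    rewrite /three_term al0 /F horner_jac1 gaugeS /gauge big_ord0 -/w /= mul1r => ->.
    ring.
  move=> jN; have := block_system_three_term mu0 sys jN.
  rewrite /three_term -/w /= => T.
  rewrite gaugeS -mulrA T mulrBr /F horner_jacSS -!/(F _ _).
  rewrite [gauge _ * (eta _ * _ * _)]mulrCA.
  have := IH1 (ltnW jN); have := IH0 (ltnW (ltnW jN)); have := albe (ltnW jN).
  rewrite gaugeS => ab g0 g1.
  have -> : gauge j * (eta j.+1 * be j.+1) * ((w + (eta j.+1 + eta j.+2 - 2)) * x j.+1)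
    = (w + (eta j.+1 + eta j.+2 - 2)) * (gauge j * (eta j.+1 * be j.+1) * x j.+1) by ring.
  rewrite g1 [RHS]mulrBr [x 0%N * (_ * F j w)]mulrCA -g0 -ab; ring.
case: (posnP N) => [N0|N0] j jN; first by rewrite N0 in jN.
have := claim _ (leqnn N); rewrite gaugeN // mul0r => /esym/eqP.
rewrite mulf_eq0 => /orP[/eqP x0|r]; last by rewrite /root -/(F N w) r in nroot.
have := claim _ (ltnW jN); rewrite x0 mul0r => /eqP; rewrite mulf_eq0.
by rewrite (negPf (gauge_neq0 jN)) => /eqP.
Qed.

(** The recurrence determines x from x_0; the vectors y and z are then read
    off from the two relations that led to the recurrence. *)
Lemma block_system_exists w : (0 < N)%N -> w != 1 -> root block_poly w ->
  exists x y z, block_system (1 - w)^-1 x y z /\ x 0%N = 1.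
Proof.
move=> N0 w1 /eqP; rewrite -/(F N w) => rw; set mu := (1 - w)^-1.
have w1' : 1 - w != 0 by rewrite subr_eq0 eq_sym.
have mu0 : mu != 0 by rewrite invr_eq0.
pose x j := F j w / gauge j.
have x0 : x 0%N = 1 by rewrite /x /gauge big_ord0 /F /= hornerE divr1.
have T j : (j < N)%N -> three_term w x j.
  move=> jN; have g0 := gauge_neq0 jN.
  have gx : gauge j * (eta j.+1 * be j.+1 * x j.+1) = F j.+1 w.
    rewrite mulrA -gaugeS; move: jN; rewrite leq_eqVlt => /orP[/eqP E|jN].
      by rewrite E gaugeN // mul0r rw.
    by rewrite /x mulrC divfK // gauge_neq0.
  apply: (mulfI g0); rewrite gx mulrBr.
  have -> : gauge j * ((w + (eta j + eta j.+1 - 2)) * x j)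
     = (w + (eta j + eta j.+1 - 2)) * F j w by rewrite /x; field.
  case: j jN g0 {gx} => [|j] jN g0.
    by rewrite al0 /F horner_jac1 /= hornerC; ring.
  rewrite /F horner_jacSS -!/(F _ _) /=; congr (_ - _).
  have gj0 := gauge_neq0 (ltnW jN).
  rewrite gaugeS -(albe (ltnW jN)) /x; field.
  by [].
exists x, (fun j => eta j.+1 * mu * (x j - be j.+1 * x j.+1) - x j),
  (fun j => eta j * mu * (x j - al j * x j.-1) - x j); split=> // j jN.
have e : eta j.+1 * mu * (x j - be j.+1 * x j.+1) - x j + x j
   + (eta j * mu * (x j - al j * x j.-1) - x j) = mu * x j.
  have := T _ jN; rewrite /three_term => t.
  have -> : eta j.+1 * mu * (x j - be j.+1 * x j.+1) - x j + x j +
    (eta j * mu * (x j - al j * x j.-1) - x j) =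
    mu * (eta j.+1 * x j - eta j.+1 * be j.+1 * x j.+1 + eta j * x j
          - eta j * al j * x j.-1) - x j by ring.
  rewrite t.
  by rewrite /mu; field.
split=> //.
  have -> : eta j.+1 * mu * (x j - be j.+1 * x j.+1) - x j =
    mu * x j - eta j * mu * (x j - al j * x j.-1) by rewrite -e; ring.
  case: j jN {e} => [|j] jN /=; first by rewrite al0 eta0; ring.
  have ab := albe (ltnW jN).
  have -> : mu * x j.+1 = mu * x j.+1 * (eta j.+1 - al j.+1 * be j.+1 * eta j.+1)
    by rewrite ab; ring.
  ring.
have -> : eta j * mu * (x j - al j * x j.-1) - x j =
    mu * x j - eta j.+1 * mu * (x j - be j.+1 * x j.+1) by rewrite -e; ring.
have ab := albe jN.
have -> : mu * x j = mu * x j * (eta j.+1 - al j.+1 * be j.+1 * eta j.+1)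
    by rewrite ab; ring.
rewrite /=; ring.
Qed.

End BlockSystem.

(** * Orders of magnitude in a small parameter *)

Section OrdersOfMagnitude.
Variables (R : rcfType) (T : Type) (s : T -> R).
Hypothesis s_gt0 : forall p, 0 < s p.
Hypothesis s_le : forall p, s p <= 1 / 2.
Implicit Types (f g : T -> R) (m : nat).

(** f = O(s^m), uniformly over the whole of T.  Instead of letting s tend to
    0, a situation to be refuted for small s is encoded in the points of T;
    the statement that 1 is O(s) on T then bounds s from below. *)
Definition Os m f := exists C, forall p, `|f p| <= C * s p ^+ m.

Let s_le1 p : s p <= 1.
Proof. have := s_le p; lra. Qed.

Let sX_ge0 p m : 0 <= s p ^+ m.
Proof. by rewrite exprn_ge0 // ltW. Qed.

Lemma Os_ext m f g : f =1 g -> Os m f -> Os m g.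
Proof. by move=> fg [C hC]; exists C => p; rewrite -fg. Qed.

Lemma Os_pos m f : Os m f -> exists2 C, 0 <= C & forall p, `|f p| <= C * s p ^+ m.
Proof.
move=> [C hC]; exists `|C| => // p; apply: le_trans (hC p) _.
by apply: ler_wpM2r; rewrite ?ler_norm.
Qed.

Lemma Os_le m m' f : (m' <= m)%N -> Os m f -> Os m' f.
Proof.
move=> mm' /Os_pos[C C0 hC]; exists C => p; apply: le_trans (hC p) _.
apply: ler_wpM2l => //; apply: ler_wiXn2l => //; exact/ltW.
Qed.

Lemma Os_D m f g : Os m f -> Os m g -> Os m (fun p => f p + g p).
Proof.
move=> [C hC] [C' hC']; exists (C + C') => p; rewrite mulrDl.
by apply: le_trans (ler_normD _ _) _; apply: lerD.
Qed.

Lemma Os_N m f : Os m f -> Os m (fun p => - f p).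
Proof. by move=> [C hC]; exists C => p; rewrite normrN. Qed.

Lemma Os_B m f g : Os m f -> Os m g -> Os m (fun p => f p - g p).
Proof. by move=> hf hg; apply: Os_D => //; apply: Os_N. Qed.

Lemma Os_M m m' f g : Os m f -> Os m' g -> Os (m + m') (fun p => f p * g p).
Proof.
move=> [C hC] [C' hC']; exists (C * C') => p.
by rewrite normrM exprD mulrACA ler_pM.
Qed.

Lemma Os_M0 m f g : Os m f -> Os 0 g -> Os m (fun p => f p * g p).
Proof. by move=> hf hg; rewrite -[m]addn0; apply: Os_M. Qed.

Lemma Os_cst (c : R) : Os 0 (fun=> c).
Proof. by exists `|c| => p; rewrite expr0 mulr1. Qed.

Lemma Os_s m : Os m (fun p => s p ^+ m).
Proof. by exists 1 => p; rewrite mul1r ger0_norm. Qed.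

Lemma Os_Z m c f : Os m f -> Os m (fun p => c * f p).
Proof. by move=> hf; rewrite -[m]add0n; apply: Os_M => //; apply: Os_cst. Qed.

Lemma Os_divs a m f : Os (a + m) (fun p => s p ^+ a * f p) -> Os m f.
Proof.
move=> [C hC]; exists C => p; have sp : 0 < s p ^+ a by rewrite exprn_gt0.
rewrite -(ler_pM2l sp) mulrCA -exprD; apply: le_trans (hC p).
by rewrite normrM (gtr0_norm sp).
Qed.

Lemma Os_unif N (f : nat -> T -> R) : (forall j, (j < N)%N -> Os 0 (f j)) ->
  exists2 C, 0 <= C & forall j, (j < N)%N -> forall p, `|f j p| <= C.
Proof.
elim: N => [|N IH] hf; first by exists 0.
have [j jN|C C0 hC] := IH; first by apply: hf; apply: ltnW.
have [C' C'0 hC'] := Os_pos (hf N (leqnn _)).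
exists (C + C'); first exact: addr_ge0.
move=> j; rewrite ltnS leq_eqVlt => /orP[/eqP->|jN] p.
  by have := hC' p; rewrite expr0; lra.
have := hC _ jN p; lra.
Qed.

Lemma Os_one (c : R) a m : c != 0 -> (a < m)%N ->
  Os m (fun p => c * s p ^+ a) -> Os 1 (fun=> 1).
Proof.
move=> c0 am h; apply: (@Os_divs a).
apply: (Os_ext (f := fun p => c^-1 * (c * s p ^+ a))) => [p|].
  by rewrite mulrA mulVf // mul1r mulr1.
by apply: Os_Z; apply: Os_le h; rewrite addn1.
Qed.

Variables (N : nat) (a c : nat -> T -> R) (y : T -> R).
Let f j p := (jac (a^~ p) (c^~ p) j).[y p].

(** The Chebyshev polynomials of the second kind, rescaled to be monic:
    the characteristic polynomials of paths. *)
Definition cheb j : {poly R} := jac (fun=> 0) (fun=> 1) j.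

Lemma cheb_lipschitz (z : R) j : Os 0 y -> Os 1 (fun p => y p - z) ->
  Os 1 (fun p => (cheb j).[y p] - (cheb j).[z]) /\ Os 0 (fun p => (cheb j).[y p]).
Proof.
move=> y0 yz; elim/jac_ind2: j => [||j [IH0 b0] [IH1 b1]].
- split; last by apply: Os_ext (Os_cst 1) => p; rewrite /cheb /= hornerC.
  by exists 0 => p; rewrite /cheb /= !hornerC subrr normr0 mul0r.
- split; first by apply: Os_ext yz => p; rewrite /cheb !horner_jac1; ring.
  by apply: Os_ext y0 => p; rewrite /cheb !horner_jac1 addr0.
split.
  apply: (Os_ext (f := fun p => y p * ((cheb j.+1).[y p] - (cheb j.+1).[z])
     + (cheb j.+1).[z] * (y p - z) - ((cheb j).[y p] - (cheb j).[z]))).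
    by move=> p; rewrite /cheb !horner_jacSS -!/(cheb _); ring.
  apply: Os_B => //; apply: Os_D; last exact: Os_Z.
  exact: (Os_M y0 IH1).
apply: (Os_ext (f := fun p => y p * (cheb j.+1).[y p] - (cheb j).[y p])).
  by move=> p; rewrite /cheb !horner_jacSS -!/(cheb _); ring.
apply: Os_B => //; exact: (Os_M y0 b1).
Qed.

Hypothesis a_small : forall j, (j < N)%N -> Os 1 (a j).
Hypothesis c_near1 : forall j, (0 < j < N)%N -> Os 1 (fun p => c j p - 1).

Lemma jac_near_cheb j : Os 0 y -> (j <= N)%N ->
  Os 1 (fun p => f j p - (cheb j).[y p]) /\ Os 0 (fun p => (cheb j).[y p]).
Proof.
move=> y0; elim/jac_ind2: j => [_|jN|j IH0 IH1 jN].
- split; last by apply: Os_ext (Os_cst 1) => p; rewrite /cheb /= hornerC.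
  by exists 0 => p; rewrite /f /cheb /= !hornerC subrr normr0 mul0r.
- split; last by apply: Os_ext y0 => p; rewrite /cheb !horner_jac1 addr0.
  by apply: Os_ext (a_small jN) => p; rewrite /f /cheb !horner_jac1; ring.
have [d0 b0] := IH0 (ltnW (ltnW jN)); have [d1 b1] := IH1 (ltnW jN).
have cN := @c_near1 j.+1 jN; have aN := a_small jN.
split; last first.
  apply: (Os_ext (f := fun p => y p * (cheb j.+1).[y p] - (cheb j).[y p])).
    by move=> p; rewrite /cheb !horner_jacSS -!/(cheb _); ring.
  apply: Os_B => //; exact: (Os_M y0 b1).
apply: (Os_ext (f := fun p => y p * (f j.+1 p - (cheb j.+1).[y p])
   + (a j.+1 p * (f j.+1 p - (cheb j.+1).[y p]) + a j.+1 p * (cheb j.+1).[y p])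
   - ((c j.+1 p - 1) * (f j p - (cheb j).[y p]) + (f j p - (cheb j).[y p])
      + (c j.+1 p - 1) * (cheb j).[y p]))).
  by move=> p; rewrite /f /cheb !horner_jacSS; ring.
apply: Os_B; apply: Os_D.
- exact: (Os_M y0 d1).
- apply: Os_D; last by apply: Os_M0.
  by apply: (@Os_le 2) => //; apply: (Os_M aN d1).
- by apply: Os_D => //; apply: (@Os_le 2) => //; apply: (Os_M cN d0).
- by apply: Os_M0.
Qed.

Variables (k m : nat) (d : nat -> R).
Hypothesis m_gt0 : (0 < m)%N.
Hypothesis m_le : (m <= k)%N.
Hypothesis a_exp : forall j, (j < N)%N -> Os k.+1 (fun p => a j p - d j * s p ^+ k).
Hypothesis y_small : Os m y.

Let a_k j : (j < N)%N -> Os k (a j).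
Proof.
move=> jN; apply: (Os_ext (f := fun p => (a j p - d j * s p ^+ k) + d j * s p ^+ k)).
  by move=> p; rewrite subrK.
apply: Os_D; first by apply: Os_le (a_exp jN).
exact/Os_Z/Os_s.
Qed.

(** Near y = 0 the polynomials of even degree stay close to +1 or -1 and
    those of odd degree vanish to first order.  The linear part in y and in
    the diagonal entries collects the contributions of the even positions,
    since deleting an odd position leaves two paths with an odd number of
    vertices, of determinant 0. *)
Lemma jac_near0 j :
  ((j.*2 <= N)%N -> Os 1 (fun p => f j.*2 p - (-1) ^+ j)) /\
  ((j.*2 < N)%N -> Os m.+1 (fun p => f j.*2.+1 p
     - (-1) ^+ j * (j.+1%:R * y p + (\sum_(i < j.+1) d i.*2) * s p ^+ k))).
Proof.
elim: j => [|j [IHe IHo]].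
  split=> [_|N0]; first by exists 0 => p; rewrite /f /= hornerC subrr normr0 mul0r.
  apply: Os_ext (Os_le _ (a_exp N0)) => // p.
  by rewrite /f horner_jac1 big_ord_recl big_ord0 /=; ring.
rewrite doubleS.
have He : (j.*2.+2 <= N)%N -> Os 1 (fun p => f j.*2.+2 p - (-1) ^+ j.+1).
  move=> jN; have jN1 := ltnW jN.
  have aN := a_k jN; have cN := @c_near1 j.*2.+1 jN.
  have fo : Os m (f j.*2.+1).
    apply: (Os_ext (f := fun p => (f j.*2.+1 p
     - (-1) ^+ j * (j.+1%:R * y p + (\sum_(i < j.+1) d i.*2) * s p ^+ k))
      + (-1) ^+ j * (j.+1%:R * y p + (\sum_(i < j.+1) d i.*2) * s p ^+ k))).
      by move=> p; rewrite subrK.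
    apply: Os_D; first exact: Os_le (IHo jN1).
    apply: Os_Z; apply: Os_D; apply: Os_Z => //; exact: Os_le (Os_s k).
  apply: (Os_ext (f := fun p => (y p + a j.*2.+1 p) * f j.*2.+1 p
    - ((c j.*2.+1 p - 1) * (f j.*2 p - (-1) ^+ j) + (f j.*2 p - (-1) ^+ j)
       + (-1) ^+ j * (c j.*2.+1 p - 1)))).
    by move=> p; rewrite /f horner_jacSS exprS; ring.
  apply: Os_B.
    apply: (@Os_le (m + m)); first by rewrite addn_gt0 m_gt0.
    by apply: Os_M => //; apply: Os_D => //; apply: Os_le aN.
  apply: Os_D; last exact: Os_Z.
  apply: Os_D; last exact: IHe (ltnW jN1).
  by apply: (@Os_le 2) => //; apply: (Os_M cN); apply: IHe (ltnW jN1).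
split=> // jN.
have {}He := He (ltnW jN); have {}IHo := IHo (ltnW (ltnW jN)).
have aN := a_k jN; have aeN := a_exp jN; have cN := @c_near1 j.*2.+2 jN.
have jN2 := ltnW jN; have jN1 := ltnW jN2.
set D := \sum_(i < j.+1) _ in IHo.
apply: (Os_ext (f := fun p => (y p + a j.*2.+2 p) * (f j.*2.+2 p - (-1) ^+ j.+1)
   + ((-1) ^+ j.+1 * (a j.*2.+2 p - d j.*2.+2 * s p ^+ k)
   - ((c j.*2.+2 p - 1) * (f j.*2.+1 p - (-1) ^+ j * (j.+1%:R * y p + D * s p ^+ k))
    + (f j.*2.+1 p - (-1) ^+ j * (j.+1%:R * y p + D * s p ^+ k))
    + (c j.*2.+2 p - 1) * ((-1) ^+ j * (j.+1%:R * y p + D * s p ^+ k)))))).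
  move=> p; have -> : \sum_(i < j.+2) d i.*2 = D + d j.+1.*2 by rewrite big_ord_recr.
  by rewrite doubleS /f !horner_jacSS -[j.+2%:R]natr1 exprS; ring.
have lin : Os m (fun p => (-1) ^+ j * (j.+1%:R * y p + D * s p ^+ k)).
  apply: Os_Z; apply: Os_D; apply: Os_Z => //; exact: Os_le (Os_s k).
apply: Os_D.
  rewrite -addn1; apply: Os_M => //; apply: Os_D => //; exact: Os_le aN.
apply: Os_B; first by apply: Os_Z; apply: Os_le aeN.
apply: Os_D.
  by apply: Os_D => //; apply: (@Os_le (1 + m.+1)) => //; apply: Os_M.
by rewrite -add1n; apply: Os_M.
Qed.

End OrdersOfMagnitude.

(** * Rational values of Chebyshev polynomials *)

Section ChebyshevRational.
Variable R : rcfType.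

(** Clearing denominators turns the recurrence into an integral one, which
    is v_(j+2) = P v_(j+1) modulo Q. *)
Lemma cheb_integral (P Q : int) j : Q != 0 ->
  exists u : int, Q%:~R ^+ j * (cheb R j).[P%:~R / Q%:~R] = (P ^+ j + Q * u)%:~R.
Proof.
move=> Q0; have Q0' : (Q%:~R : R) != 0 by rewrite intr_eq0.
elim/jac_ind2: j => [||j [u0 IH0] [u1 IH1]].
- by exists 0; rewrite mulr0 addr0 !expr0 /cheb /= hornerC mulr1.
- by exists 0; rewrite mulr0 addr0 !expr1 /cheb horner_jac1 addr0 mulrC divfK.
exists (P * u1 - Q * (P ^+ j + Q * u0)).
have -> : P ^+ j.+2 + Q * (P * u1 - Q * (P ^+ j + Q * u0)) =
  P * (P ^+ j.+1 + Q * u1) - Q * Q * (P ^+ j + Q * u0) by rewrite !exprS; ring.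
rewrite intrB ![in RHS]intrM -IH0 -IH1 /cheb horner_jacSS -!/(cheb _ _) !exprS.
by field.
Qed.

Lemma cheb_coprime_neq0 (P Q : int) j : Q != 0 -> coprime `|Q| `|P| -> `|Q|%N != 1%N ->
  (cheb R j).[P%:~R / Q%:~R] != 0.
Proof.
move=> Q0 cop Q1; apply/eqP => r0; have [u] := @cheb_integral P Q j Q0.
rewrite r0 mulr0 => /esym/eqP; rewrite intr_eq0 addr_eq0 => /eqP e.
have : (Q %| P ^+ j)%Z by rewrite e -mulrN dvdz_mulr.
rewrite dvdzE abszX => /gcdn_idPl h.
by move: (coprimeXr j cop); rewrite /coprime h (negPf Q1).
Qed.

(** In lowest terms the denominator of 2r/(r+1) is r+1 or (r+1)/2, according
    to the parity of r, and it is 1 for r = 1 only; a monic integral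
    polynomial has no root with a denominator other than 1. *)
Lemma cheb_neq0 r j : (0 < r)%N -> (r = 1%N -> j = 1%N) ->
  (cheb R j).[- (2 * r%:R / r.+1%:R)] != 0.
Proof.
move=> r0 r1; have [rE | rn1] := eqVneq r 1%N.
  by rewrite (r1 rE) rE /cheb horner_jac1 addr0 mulr1 divff ?oppr_eq0 ?oner_eq0 ?pnatr_eq0.
have [odr|evr] := boolP (odd r).
  pose Q := uphalf r; have rQ : (r.+1 = Q + Q)%N by rewrite /Q; lia.
  have -> : - (2 * r%:R / r.+1%:R) = (- r%:Z)%:~R / (Q%:Z)%:~R :> R.
    have Q0 : (Q%:R : R) != 0 by rewrite pnatr_eq0 /Q; lia.
    rewrite rQ natrD mulrNz -!pmulrn; field.
    by rewrite Q0 -mulr2n mulrn_eq0 Q0.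
  apply: cheb_coprime_neq0; rewrite ?abszN ?absz_nat /Q; try lia.
  rewrite coprime_sym /coprime -dvdn1.
  have -> : 1%N = (uphalf r + uphalf r - r)%N by lia.
  by rewrite dvdn_sub ?dvdn_add ?dvdn_gcdl ?dvdn_gcdr.
have -> : - (2 * r%:R / r.+1%:R) = (- (2 * r)%N%:Z)%:~R / (r.+1%:Z)%:~R :> R.
  by rewrite mulrNz -!pmulrn natrM mulNr.
apply: cheb_coprime_neq0; rewrite ?abszN ?absz_nat //; try lia.
rewrite coprimeMr coprimen2 /= evr.
by rewrite coprimeSn.
Qed.

End ChebyshevRational.
(** * Two block polynomials have no common root for large fields *)

Section Asymptotics.
Variables (R : rcfType) (n : nat).

(** With s = 1/sqrt q this is q^(2k) [j] [N-j] / ([k] [n+1-k]), for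
    N = n+1-2k; all its factors tend to 1 with s for 0 < j < N. *)
Definition ratio k (s : R) j : R :=
  (1 - s ^+ (2 * j)) * (1 - s ^+ (2 * (n.+1 - 2 * k - j)))
  / ((1 - s ^+ (2 * k)) * (1 - s ^+ (2 * (n.+1 - k)))).

Definition eta k (s : R) j : R := 1 + s ^+ (2 * k) * ratio k s j.

Definition spectral_poly k (s : R) : {poly R} := block_poly (n.+1 - 2 * k) (eta k s).

Lemma ratio0 k s : ratio k s 0 = 0.
Proof. by rewrite /ratio muln0 expr0 subrr !mul0r. Qed.

Lemma ratioN k s : ratio k s (n.+1 - 2 * k) = 0.
Proof. by rewrite /ratio subnn muln0 expr0 subrr mulr0 mul0r. Qed.

Definition scaled_a k s j : R := s ^+ k * (ratio k s j + ratio k s j.+1).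
Definition scaled_c k s j : R := ratio k s j * (1 + s ^+ (2 * k) * ratio k s j).

(** The substitution w = s^k y produces coefficients with finite limits: the
    diagonal tends to 0 and the off-diagonal products tend to 1, the matrix
    of a path. *)
Lemma spectral_poly_scaled k s y : (spectral_poly k s).[s ^+ k * y] =
  s ^+ k ^+ (n.+1 - 2 * k) * (jac (scaled_a k s) (scaled_c k s) (n.+1 - 2 * k)).[y].
Proof.
rewrite -jac_scale /spectral_poly /block_poly; congr (_.[_]).
have e : s ^+ (2 * k) = s ^+ k * s ^+ k by rewrite mul2n -addnn exprD.
by apply: eq_jac => i _; rewrite /eta /scaled_a /scaled_c e; ring.
Qed.

Lemma one_minus_ge (s : R) j : 0 < s <= 1 / 2 -> (0 < j)%N ->
  1 / 2 <= 1 - s ^+ (2 * j) <= 1.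
Proof.
move=> /andP[s0 s1] j0.
have h1 : s ^+ (2 * j) <= s by rewrite -[leRHS]expr1 ler_wiXn2l ?(ltW s0) //; [lra|lia].
have h2 : 0 <= s ^+ (2 * j) by rewrite exprn_ge0 // ltW.
by apply/andP; split; lra.
Qed.

Lemma ratio_gt0 k s j : 0 < s <= 1 / 2 -> (0 < k)%N -> (2 * k <= n)%N ->
  (0 < j < n.+1 - 2 * k)%N -> 0 < ratio k s j.
Proof.
move=> hs k0 kn /andP[j0 jN].
have h i : (0 < i)%N -> 0 < 1 - s ^+ (2 * i).
  move=> i0; have /andP[h _] := one_minus_ge hs i0; lra.
by rewrite /ratio divr_gt0 // mulr_gt0 // h //; lia.
Qed.

Section Parametrized.
Variables (T : Type) (s w : T -> R).
Hypothesis s_gt0 : forall p, 0 < s p.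
Hypothesis s_le : forall p, s p <= 1 / 2.
Notation O := (Os s).

Let s_in p : 0 < s p <= 1 / 2. Proof. by rewrite s_gt0 s_le. Qed.

Section OneBlock.
Variable k : nat.
Hypotheses (k_gt0 : (0 < k)%N) (k_le : (2 * k <= n)%N).
Hypothesis w_root : forall p, root (spectral_poly k (s p)) (w p).
Let N := (n.+1 - 2 * k)%N.

Lemma ratio_near1 j : (0 < j < N)%N -> O 1 (fun p => ratio k (s p) j - 1).
Proof.
move=> /andP[j0 jN].
pose den p := (1 - s p ^+ (2 * k)) * (1 - s p ^+ (2 * (n.+1 - k))).
have den_ge p : 1 / 4 <= den p.
  have /andP[h1 _] := one_minus_ge (s_in p) k_gt0.
  have /andP[h2 _] : 1 / 2 <= 1 - s p ^+ (2 * (n.+1 - k)) <= 1.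
    by apply: one_minus_ge => //; lia.
  by rewrite /den; nra.
have deni : O 0 (fun p => (den p)^-1).
  exists 4 => p; rewrite expr0 mulr1; have d := den_ge p; have d0 : 0 < den p by lra.
  rewrite ger0_norm ?invr_ge0 ?(ltW d0) //.
  have v0 : 0 <= (den p)^-1 by rewrite invr_ge0 ltW.
  have e : (den p)^-1 * den p = 1 by rewrite mulVf // gt_eqF.
  by have := ler_wpM2l v0 d; rewrite e; lra.
have pow i : (0 < i)%N -> O 1 (fun p => s p ^+ (2 * i)).
  by move=> i0; apply: (Os_le s_gt0 s_le _ (Os_s s_gt0 (2 * i))); lia.
have pow2 i i' : (0 < i)%N -> O 1 (fun p => s p ^+ (2 * i) * s p ^+ (2 * i')).
  move=> i0; apply: Os_M0; first exact: pow.
  by apply: (Os_le s_gt0 s_le (leq0n (2 * i'))); apply: Os_s.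
apply: (Os_ext (f := fun p => (((s p ^+ (2 * k) + s p ^+ (2 * (n.+1 - k))) -
   s p ^+ (2 * k) * s p ^+ (2 * (n.+1 - k)))
   - ((s p ^+ (2 * j) + s p ^+ (2 * (n.+1 - 2 * k - j)))
   - s p ^+ (2 * j) * s p ^+ (2 * (n.+1 - 2 * k - j)))) * (den p)^-1)).
  move=> p; have d : den p != 0 by have d0 := den_ge p; rewrite gt_eqF //; lra.
  rewrite /ratio -/(den p) -[X in _ = _ - X](divff d) -mulrBl /den; congr (_ * _).
  ring.
apply: Os_M0 => //.
by apply: Os_B; apply: Os_B; (apply: Os_D; apply: pow; lia) || (apply: pow2; lia).
Qed.

Let ratio_ind j : (j <= N)%N -> O 1 (fun p => ratio k (s p) j - (0 < j < N)%N%:R).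
Proof.
have zero : O 1 (fun p => 0 - 0).
  by exists 0 => p; rewrite subr0 normr0 mul0r.
case: j => [|j] jN; first by apply: Os_ext zero => p; rewrite ratio0.
move: jN; rewrite leq_eqVlt => /orP[/eqP E|jN]; last first.
  by rewrite jN /=; apply: ratio_near1.
by rewrite E ltnn andbF; apply: Os_ext zero => p; rewrite ratioN.
Qed.

Let ratio_bounded j : (j <= N)%N -> O 0 (fun p => ratio k (s p) j).
Proof.
move=> jN; have h := Os_le s_gt0 s_le (leq0n 1) (ratio_ind jN).
by apply: (Os_ext _ (Os_D h (Os_cst s (0 < j < N)%N%:R))) => p; rewrite subrK.
Qed.

(** The limit of the diagonal entry at j, divided by s^k: 2 inside, 1 at the
    two ends of a block of size at least 2. *)
Let mult j : R := (0 < j < N)%N%:R + (0 < j.+1 < N)%N%:R.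

Let a_exp j : (j < N)%N ->
  O k.+1 (fun p => scaled_a k (s p) j - mult j * s p ^+ k).
Proof.
move=> jN; apply: (Os_ext (f := fun p => s p ^+ k *
   ((ratio k (s p) j - (0 < j < N)%N%:R) + (ratio k (s p) j.+1 - (0 < j.+1 < N)%N%:R)))).
  by move=> p; rewrite /scaled_a /mult; ring.
rewrite -addn1; apply: Os_M; first exact: Os_s.
by apply: Os_D; apply: ratio_ind => //; apply: ltnW.
Qed.

Let a_small j : (j < N)%N -> O 1 (fun p => scaled_a k (s p) j).
Proof.
move=> jN.
apply: Os_M0.
  exact: (Os_le s_gt0 s_le k_gt0 (Os_s s_gt0 k)).
by apply: Os_D; apply: ratio_bounded => //; apply: ltnW.
Qed.

Let c_near1 j : (0 < j < N)%N -> O 1 (fun p => scaled_c k (s p) j - 1).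
Proof.
move=> jN; have /andP[_ /ltnW jN'] := jN.
apply: (Os_ext (f := fun p => (ratio k (s p) j - 1) +
   s p ^+ (2 * k) * (ratio k (s p) j * ratio k (s p) j))).
  by move=> p; rewrite /scaled_c; ring.
apply: Os_D; first exact: ratio_near1.
apply: Os_M0.
  by apply: (Os_le s_gt0 s_le _ (Os_s s_gt0 (2 * k))); lia.
by apply: Os_M0; apply: ratio_bounded.
Qed.

Definition scaled_root p := w p / s p ^+ k.

Lemma scaled_rootK p : s p ^+ k * scaled_root p = w p.
Proof. by rewrite mulrC divfK // expf_neq0 // gt_eqF. Qed.

Lemma scaled_rootP p :
  root (jac (scaled_a k (s p)) (scaled_c k (s p)) N) (scaled_root p).
Proof.
have := w_root p; rewrite -(scaled_rootK p) /root spectral_poly_scaled mulf_eq0.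
by rewrite expf_eq0 expf_eq0 gt_eqF // !andbF.
Qed.

Lemma scaled_root_bounded : O 0 scaled_root.
Proof.
have a0 j : (j < N)%N -> O 0 (fun p => scaled_a k (s p) j).
  by move=> jN; apply: (Os_le s_gt0 s_le (leq0n 1)); apply: a_small.
have c0 j : (j < N)%N -> O 0 (fun p => scaled_c k (s p) j).
  move=> jN; have jN' := ltnW jN.
  apply: Os_M0; first exact: ratio_bounded.
  apply: Os_D; first exact: Os_cst.
  apply: Os_M0; last exact: ratio_bounded.
  exact: (Os_le s_gt0 s_le (leq0n (2 * k)) (Os_s s_gt0 (2 * k))).
have [A A0 hA] := Os_unif s_gt0 a0; have [C C0 hC] := Os_unif s_gt0 c0.
exists (A + C + 1) => p; rewrite expr0 mulr1.
apply: (jac_root_bound C0 _ _ (scaled_rootP p)) => j; first by move=> /hA; apply.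
by case/andP=> _ /hC; apply.
Qed.

Lemma root_size : O k w.
Proof.
apply: (Os_ext (f := fun p => s p ^+ k * scaled_root p)); first exact: scaled_rootK.
by apply: Os_M0; [apply: Os_s|apply: scaled_root_bounded].
Qed.

Lemma scaled_root_small m : O (k + m) w -> O m scaled_root.
Proof.
move=> hw; apply: (Os_divs s_gt0 (a := k)).
by apply: Os_ext hw => p; rewrite scaled_rootK.
Qed.

(** A path with an even number of vertices is nonsingular: such a block has
    no root that is small compared with s^k. *)
Lemma small_root_even : ~~ odd N -> O k.+1 w -> O 1 (fun=> 1).
Proof.
move=> evN; rewrite -addn1 => /scaled_root_small y1.
have [He _] := jac_near0 s_gt0 s_le c_near1 (ltn0Sn 0) k_gt0 a_exp y1 N./2.
have NE : N./2.*2 = N by rewrite even_halfK.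
have := He; rewrite NE => /(_ (leqnn _)).
move=> /(Os_Z (- (-1) ^+ N./2)); apply: Os_ext => p.
rewrite (eqP (scaled_rootP p)) sub0r mulrNN -exprMn mulrNN mulr1 expr1n //.
Qed.

Lemma mult_sum r : N = r.*2.+1 -> \sum_(i < r.+1) mult i.*2 = 2 * r%:R.
Proof.
move=> Nr.
have e (i : 'I_r.+1) : mult i.*2 = (0 < i)%N%:R + (i < r)%N%:R.
  rewrite /mult Nr; have := ltn_ord i; move: (nat_of_ord i) => {}i ir.
  by congr ((nat_of_bool _)%:R + (nat_of_bool _)%:R); lia.
rewrite (eq_bigr _ (fun i _ => e i)) big_split /= -!natr_sum.
have -> : (\sum_(i < r.+1) (0 < i) = r)%N.
  by rewrite big_ord_recl /= add0n sum1_card card_ord.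
have -> : (\sum_(i < r.+1) (i < r) = r)%N.
  rewrite big_ord_recr /= ltnn addn0 (eq_bigr (fun=> 1%N)) ?sum1_card ?card_ord //.
  by move=> i _; rewrite ltn_ord.
ring.
Qed.

(** The expansion near 0 reads (r+1) y + 2r s^k = o(|y| + s^k).  Starting
    from y = O(s), each use of it improves the bound on y by one power of s,
    up to y = O(s^k), where it gives the position of the root. *)
Lemma small_root_odd r : N = r.*2.+1 -> O k.+1 w ->
  O (2 * k).+1 (fun p => r.+1%:R * w p + 2 * r%:R * s p ^+ (2 * k)).
Proof.
move=> Nr hw.
have exp m : (0 < m)%N -> (m <= k)%N -> O m scaled_root ->
   O m.+1 (fun p => r.+1%:R * scaled_root p + 2 * r%:R * s p ^+ k).
  move=> m0 mk ym.
  have [_] := jac_near0 s_gt0 s_le c_near1 m0 mk a_exp ym r.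
  have hN : (r.*2 < N)%N by rewrite Nr.
  move=> /(_ hN); rewrite -Nr => /(Os_Z (- (-1) ^+ r)); apply: Os_ext => p.
  rewrite (eqP (scaled_rootP p)) sub0r mulrNN mulrA -exprMn mulrNN mulr1 expr1n mul1r.
  by rewrite mult_sum.
have yk : O k scaled_root.
  have step m : (m < k)%N -> O m.+1 scaled_root.
    elim: m => [|m IH] mk; first by apply: scaled_root_small; rewrite addn1.
    have := exp _ (ltn0Sn m) (ltnW mk) (IH (ltnW mk)) => h.
    have r0 : (r.+1%:R : R) != 0 by rewrite pnatr_eq0.
    apply: (Os_ext (f := fun p => r.+1%:R^-1 *
      ((r.+1%:R * scaled_root p + 2 * r%:R * s p ^+ k) - 2 * r%:R * s p ^+ k))).
      by move=> p; rewrite addrK mulKf.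
    apply: Os_Z; apply: Os_B => //; apply: Os_Z.
    exact: (Os_le s_gt0 s_le mk (Os_s s_gt0 k)).
  by have := step k.-1; rewrite prednK // leqnn; apply.
have h := exp _ k_gt0 (leqnn k) yk.
have -> : ((2 * k).+1 = k + k.+1)%N by lia.
apply: (Os_ext (f := fun p => s p ^+ k * (r.+1%:R * scaled_root p + 2 * r%:R * s p ^+ k))).
  move=> p; rewrite -(scaled_rootK p).
  have -> : s p ^+ (2 * k) = s p ^+ k * s p ^+ k by rewrite -exprD addnn mul2n.
  ring.
by apply: Os_M => //; apply: Os_s.
Qed.

Lemma scaled_root_cheb z : O 1 (fun p => scaled_root p - z) ->
  O 1 (fun p => (cheb R N).[z]).
Proof.
move=> yz; have y0 := scaled_root_bounded.
have [h1 _] := jac_near_cheb s_gt0 s_le a_small c_near1 y0 (leqnn N).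
have [h2 _] := cheb_lipschitz N y0 yz.
have := Os_N (Os_D h1 h2); apply: Os_ext => p.
by rewrite (eqP (scaled_rootP p)); ring.
Qed.

End OneBlock.

(** A common root is O(s^k'), too small for block k unless it is the
    exceptional root near -2r/(r+1) s^(2k); comparing that with the roots of
    block k' forces k' = 2k, which the arithmetic of cheb_neq0 excludes. *)
Lemma common_root_absurd k k' : (0 < k)%N -> (k < k')%N -> (2 * k' <= n)%N ->
  (forall p, root (spectral_poly k (s p)) (w p)) ->
  (forall p, root (spectral_poly k' (s p)) (w p)) -> O 1 (fun=> 1).
Proof.
move=> k0 kk' k'n rk rk'.
have k'0 : (0 < k')%N by lia.
have kn : (2 * k <= n)%N by lia.
have hw' := root_size k'0 k'n rk'.
have hw : O k.+1 w by apply: Os_le hw'.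
have [oddN|evN] := boolP (odd (n.+1 - 2 * k)); last exact: small_root_even rk evN hw.
pose r := (n./2 - k)%N; pose r' := (n./2 - k')%N.
have evn : ~~ odd n by move: oddN; rewrite oddB ?(leqW kn) // mul2n odd_double addbF.
have nE : n = n./2.*2 by rewrite even_halfK.
have Nr : (n.+1 - 2 * k = r.*2.+1)%N by rewrite /r; lia.
have Nr' : (n.+1 - 2 * k' = r'.*2.+1)%N by rewrite /r'; lia.
have r_gt0 : (0 < r)%N by rewrite /r; lia.
have solve a (u : nat) : O a (fun p => u.+1%:R * w p + 2 * u%:R * s p ^+ a) -> O a w.
  move=> h; have u0 : (u.+1%:R : R) != 0 by rewrite pnatr_eq0.
  apply: (Os_ext (f := fun p => u.+1%:R^-1 *
    ((u.+1%:R * w p + 2 * u%:R * s p ^+ a) - 2 * u%:R * s p ^+ a))).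
    by move=> p; rewrite addrK mulKf.
  by apply: Os_Z; apply: Os_B => //; apply: Os_Z; apply: Os_s.
have H := small_root_odd k0 kn rk Nr hw.
have fin : O (2 * k).+1 w -> O 1 (fun=> 1).
  move=> hw2; apply: (@Os_one _ _ _ s_gt0 s_le (2 * r%:R) (2 * k) (2 * k).+1) => //.
    by rewrite mulf_neq0 ?pnatr_eq0 // -lt0n.
  apply: (Os_ext (f := fun p => (r.+1%:R * w p + 2 * r%:R * s p ^+ (2 * k)) - r.+1%:R * w p)).
    by move=> p; rewrite addrAC subrr add0r.
  by apply: Os_B => //; apply: Os_Z.
(* If k' < 2k, then w = O(s^(2k)) is a small root of block k' as well, hence
   O(s^(2k')), too small for block k.  If k' > 2k, then w = O(s^k') is too
   small already.  If k' = 2k, then w / s^k' tends to z, which is therefore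
   a root of the limit polynomial of block k'. *)
have [lt|gt|E] := ltngtP k' (2 * k)%N.
- have hk : O (2 * k) w by apply: solve (Os_le s_gt0 s_le (leqnSn _) H).
  have hw2 : O k'.+1 w by apply: Os_le hk.
  have H' := small_root_odd k'0 k'n rk' Nr' hw2.
  have hk' : O (2 * k') w by apply: solve (Os_le s_gt0 s_le (leqnSn _) H').
  by apply: fin; apply: Os_le hk' => //; lia.
- by apply: fin; apply: Os_le hw'.
pose z : R := - (2 * r%:R / r.+1%:R).
have yz : O 1 (fun p => scaled_root k' p - z).
  apply: (Os_divs s_gt0 (a := k')).
  have r0 : (r.+1%:R : R) != 0 by rewrite pnatr_eq0.
  apply: (Os_ext (f := fun p => r.+1%:R^-1 * (r.+1%:R * w p + 2 * r%:R * s p ^+ (2 * k)))).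
    move=> p; rewrite mulrBr scaled_rootK E /z.
    by move: (r.+1%:R) r0 => u u0; field.
  by apply: Os_Z; rewrite addn1 E.
have := scaled_root_cheb k'0 k'n rk' yz; rewrite Nr' => h.
apply: (@Os_one _ _ _ s_gt0 s_le (cheb R r'.*2.+1).[z] 0 1) => //; last first.
  by apply: Os_ext h => p; rewrite mulr1.
apply: cheb_neq0 => // r1; rewrite /r in r1; rewrite /r'; lia.
Qed.

End Parametrized.
End Asymptotics.

Lemma block_roots_disjoint (R : rcfType) n k k' :
  (0 < k)%N -> (k < k')%N -> (2 * k' <= n)%N ->
  exists2 s0 : R, 0 < s0 & forall s w : R, 0 < s <= s0 ->
    root (spectral_poly n k s) w -> ~~ root (spectral_poly n k' s) w.
Proof.
move=> k0 kk' k'n.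
pose T := {p : R * R | [/\ 0 < p.1 <= 1 / 2, root (spectral_poly n k p.1) p.2
                         & root (spectral_poly n k' p.1) p.2]}.
have [||||C hC] := @common_root_absurd R n T (fun p => (sval p).1) (fun p => (sval p).2)
  _ _ k k' k0 kk' k'n; try by case=> -[s w] [/= /andP[]].
have C1 : 0 < `|C| + 1 by rewrite ltr_wpDl.
exists (Num.min (1 / 2) (`|C| + 1)^-1).
  by rewrite lt_min invr_gt0 C1 andbT; lra.
move=> s w; rewrite le_min => /and3P[s0 s1 s2] rk; apply/negP => rk'.
have hp : [/\ 0 < (s, w).1 <= 1 / 2, root (spectral_poly n k (s, w).1) (s, w).2
                         & root (spectral_poly n k' (s, w).1) (s, w).2].
  by rewrite /= s0 s1.
have := hC (exist _ (s, w) hp); rewrite /= normr1 expr1.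
have : C * s <= `|C| * s by rewrite ler_wpM2r ?ler_norm // ltW.
have : s * (`|C| + 1) <= 1.
  by rewrite -[leRHS](@mulVf _ (`|C| + 1)) ?gt_eqF // ler_wpM2r // ltW.
lra.
Qed.

Lemma block_root_small (R : rcfType) n k : (0 < k)%N -> (2 * k <= n)%N ->
  exists2 C : R, 0 <= C & forall s w : R, 0 < s <= 1 / 2 ->
    root (spectral_poly n k s) w -> `|w| <= C * s.
Proof.
move=> k0 kn.
pose T := {p : R * R | 0 < p.1 <= 1 / 2 /\ root (spectral_poly n k p.1) p.2}.
have s0 (p : T) : 0 < (sval p).1 by case: p => -[s w] [/= /andP[]].
have s1 (p : T) : (sval p).1 <= 1 / 2 by case: p => -[s w] [/= /andP[]].
have rt (p : T) : root (spectral_poly n k (sval p).1) (sval p).2 by case: p => -[s w] [].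
have h := root_size (w := fun p : T => (sval p).2) s0 s1 k0 kn rt.
have [C C0 hC] := Os_pos s0 (Os_le s0 s1 k0 h).
by exists C => // s w hs hr; have := hC (exist _ (s, w) (conj hs hr)).
Qed.

(** * Subspaces of a finite vector space *)

Section Subspaces.
Variables (F : finFieldType) (n : nat).
Notation G := {vspace 'rV[F]_n}.
Implicit Types U V W : G.

Lemma dim_fullv : \dim (fullv : G) = n.
Proof. by rewrite dimvf /dim /= mul1n. Qed.

Lemma dim_le V : (\dim V <= n)%N.
Proof. by rewrite -[leqRHS]dim_fullv dimvS ?subvf. Qed.

Section Automorphism.

Lemma flag_basis U V : (U <= V)%VS ->
  exists X1 X2 X3 : seq 'rV[F]_n,
    [/\ <<X1>>%VS = U, <<X1 ++ X2>>%VS = V, basis_of fullv (X1 ++ X2 ++ X3)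
      & [/\ size X1 = \dim U, size X2 = (\dim V - \dim U)%N
          & size X3 = (n - \dim V)%N]].
Proof.
move=> UV; exists (vbasis U), (vbasis (V :\: U)), (vbasis (V^C)).
have dVU : (U + (V :\: U))%VS = V by rewrite addvC addv_diff; apply/addv_idPl.
have b12 : basis_of V (vbasis U ++ vbasis (V :\: U)).
  rewrite -{1}dVU; apply: cat_basis; rewrite ?vbasisP //.
  by apply/directv_addP; rewrite capvC capv_diff.
have b123 : basis_of fullv ((vbasis U ++ vbasis (V :\: U)) ++ vbasis (V^C)).
  rewrite -(addv_complf V); apply: cat_basis; rewrite ?vbasisP //.
  by apply/directv_addP; apply: capv_compl.
have s1 : size (vbasis U) = \dim U by rewrite size_tuple.
have sz (U0 : G) X : basis_of U0 X -> size X = \dim U0.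
  by move=> bX; rewrite -(span_basis bX); apply/esym/eqP/(basis_free bX).
have := sz _ _ b12; rewrite size_cat s1 => s12.
have := sz _ _ b123; rewrite size_cat size_cat s1 dim_fullv => s123.
split; rewrite ?(span_basis (vbasisP _)) ?(span_basis b12) ?catA //.
have sub (i j m : nat) : (i + j = m)%N -> j = (m - i)%N by lia.
split=> //; apply: sub => //.
by rewrite s12 in s123.
Qed.

Lemma linear_extension (X Y : seq 'rV[F]_n) : basis_of fullv X -> size X = size Y ->
  exists g : 'End('rV[F]_n), map g X = Y.
Proof.
move=> bX sXY; have fX := basis_free bX.
pose f (v : 'rV[F]_n) := \sum_(i < size X) coord (in_tuple X) i v *: Y`_i.
have lf : linear f.
  move=> a u v; rewrite /f scaler_sumr -big_split /=; apply: eq_bigr => i _.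
  by rewrite linearP scalerDl scalerA.
pose fl := GRing.isLinear.Build _ _ _ _ f lf.
pose fL : {linear 'rV[F]_n -> 'rV[F]_n} := HB.pack f fl.
exists (linfun fL); apply: (@eq_from_nth _ 0); rewrite size_map // => i iX.
rewrite (nth_map 0) // lfunE /= /f.
rewrite (bigD1 (Ordinal iX)) //= big1 => [|j ji].
  by rewrite (coord_free (Ordinal iX) (Ordinal iX)) // eqxx scale1r addr0.
rewrite (coord_free (Ordinal iX) j) // (_ : _ == _ = false) ?scale0r //.
by apply: contraNF ji => /eqP E; apply/eqP/val_inj; rewrite E.
Qed.

(** A basis of the ambient space adapted to U and V can be mapped to one
    adapted to U' and V'. *)
Lemma flag_transitive U V U' V' : (U <= V)%VS -> (U' <= V')%VS ->
  \dim U = \dim U' -> \dim V = \dim V' ->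
  exists g : 'End('rV[F]_n), [/\ lker g == 0%VS, (g @: U)%VS = U' & (g @: V)%VS = V'].
Proof.
move=> UV UV' dU dV.
have [X1 [X2 [X3 [sU sV bX [s1 s2 s3]]]]] := flag_basis UV.
have [Y1 [Y2 [Y3 [tU tV bY [t1 t2 t3]]]]] := flag_basis UV'.
have [|g gXY] := @linear_extension _ (Y1 ++ Y2 ++ Y3) bX.
  by rewrite !size_cat s1 s2 s3 t1 t2 t3 dU dV.
have e1 : map g X1 = Y1.
  have := congr1 (take (\dim U)) gXY; rewrite !map_cat !take_size_cat //.
    by rewrite t1 dU.
  by rewrite size_map.
have e2 : map g X2 = Y2.
  have := congr1 (drop (\dim U)) gXY; rewrite !map_cat !drop_size_cat //.
  - have sz : size (map g X2) = size Y2 by rewrite size_map s2 t2 dU dV.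
    by move/eqP; rewrite eqseq_cat // => /andP[/eqP].
  - by rewrite t1 dU.
  by rewrite size_map.
exists g; split.
- have : (limg g = fullv)%VS.
    by apply: etrans (span_basis bY); rewrite -gXY -limg_span (span_basis bX).
  have := limg_ker_dim g fullv; rewrite capfv => /[swap] ->.
  by rewrite -dimv_eq0; lia.
- by rewrite -sU limg_span e1.
- by rewrite -sV limg_span map_cat e1 e2.
Qed.

End Automorphism.

Section Orthogonal.
Implicit Types (u v : 'rV[F]_n).

Let rows V : 'M[F]_(\dim V, n) := \matrix_(i < \dim V) (vbasis V)`_i.

Let rows_mul V (z : 'rV[F]_(\dim V)) : z *m rows V = \sum_i z 0 i *: (vbasis V)`_i.
Proof. by rewrite mulmx_sum_row; apply: eq_bigr => i _; rewrite rowK. Qed.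

Let pairing V : 'Hom('rV[F]_n, 'rV[F]_(\dim V)) := linfun (mulmxr (rows V)^T).

(** The orthogonal for the standard bilinear form; it exchanges smaller and
    larger subspaces, hence lower and upper covers. *)
Definition perp V : G := lker (pairing V).

Lemma perpP V v : reflect (forall u, u \in V -> v *m u^T = 0) (v \in perp V).
Proof.
rewrite memv_ker lfunE /=; apply: (iffP eqP) => [h u uV|h].
  have : u = (\row_i coord (vbasis V) i u) *m rows V.
    by rewrite rows_mul {1}(coord_vbasis uV); apply: eq_bigr => i _; rewrite mxE.
  by move->; rewrite trmx_mul mulmxA h mul0mx.
apply/rowP => i; have /h : (vbasis V)`_i \in V.
  by rewrite vbasis_mem // mem_nth // size_tuple.
move=> /matrixP/(_ 0 0); rewrite !mxE => e; rewrite -[RHS]e.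
by apply: eq_bigr => j _; rewrite !mxE.
Qed.

Lemma dim_perp V : \dim (perp V) = (n - \dim V)%N.
Proof.
have fr : row_free (rows V).
  apply/inj_row_free => z; rewrite rows_mul => h; apply/rowP => i.
  by rewrite mxE; have /freeP := basis_free (vbasisP V); apply.
have := limg_ker_dim (pairing V) fullv.
rewrite capfv dim_fullv -/(perp V).
suff -> : limg (pairing V) = fullv.
  by rewrite dimvf /dim /= mul1n => /(canRL (addnK _)).
apply/eqP; rewrite eqEsubv subvf /=; apply/subvP => z _.
apply/memv_imgP; exists (z *m (pinvmx (rows V))^T); first exact: memvf.
by rewrite lfunE /= -mulmxA -trmx_mul mulmxVp // trmx1 mulmx1.
Qed.

Lemma perpS U V : (U <= V)%VS -> (perp V <= perp U)%VS.
Proof.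
by move=> /subvP UV; apply/subvP => v /perpP h; apply/perpP => u /UV; apply: h.
Qed.

Lemma perpK : involutive perp.
Proof.
move=> V; apply/eqP; rewrite eq_sym eqEdim !dim_perp subKn ?dim_le // leqnn andbT.
apply/subvP => u uV; apply/perpP => v /perpP/(_ u uV) h.
by rewrite -[u]trmxK -trmx_mul h trmx0.
Qed.

Lemma perp_sub U V : (perp V <= perp U)%VS = (U <= V)%VS.
Proof. by apply/idP/idP => /perpS //; rewrite !perpK. Qed.

End Orthogonal.

Definition covers W V := (W <= V)%VS && (\dim V == (\dim W).+1).

Lemma covers_perp W V : covers (perp V) (perp W) = covers W V.
Proof.
rewrite /covers perp_sub !dim_perp; case: (_ <= _)%VS => //=.
by have := dim_le V; have := dim_le W; lia.
Qed.

Lemma dim_addv_line W v : v \notin W -> \dim (W + <[v]>) = (\dim W).+1.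
Proof.
move=> vW; apply/eqP; rewrite eqn_leq; apply/andP; split.
  apply: leq_trans (dimv_add_leqif W <[v]>).1 _.
  by rewrite -[leqRHS]addn1 leq_add2l dim_vline leq_b1.
rewrite ltnNge; apply: contra vW => le.
have /eqP-> : W == (W + <[v]>)%VS by rewrite eqEdim addvSl.
by rewrite (subvP (addvSr _ _)) ?memv_line.
Qed.

(** Each vector outside W spans an upper cover V with W, and V arises from
    the vectors of V outside W. *)
Lemma card_upper_covers W :
  (#|[set V : G | covers W V]| * (#|F| ^ (\dim W).+1 - #|F| ^ \dim W) =
   #|F| ^ n - #|F| ^ \dim W)%N.
Proof.
have cardC V : (W <= V)%VS ->
    #|[set v in V | v \notin W]| = (#|F| ^ \dim V - #|F| ^ \dim W)%N.
  move=> WV; rewrite -(card_vspace V) -(card_vspace W) -(cardID (mem W) (mem V)).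
  have -> : #|[predI mem V & mem W]| = #|W|.
    apply: eq_card => v; rewrite !inE.
    by case vW: (v \in W); rewrite ?andbF // (subvP WV).
  by rewrite addKn; apply: eq_card => v; rewrite !inE andbC.
have := cardC fullv (subvf W); rewrite dim_fullv => <-.
rewrite -[RHS]sum1_card (partition_big (fun v => (W + <[v]>)%VS) (fun V => covers W V)) /=.
  rewrite -sum1_card big_distrl /=; apply: eq_big => [V|V]; rewrite inE // => /andP[WV /eqP dV].
  rewrite mul1n -dV -cardC // -sum1_card; apply: eq_bigl => v.
  rewrite !inE memvf /=; case vW: (v \in W) => //=; rewrite ?andbF //= andbT.
  apply/idP/eqP => [vV|<-]; last by rewrite (subvP (addvSr _ _)) ?memv_line.
  apply/eqP; rewrite eqEdim subv_add WV -memvE vV /= dV.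
  by rewrite dim_addv_line ?vW.
by move=> v; rewrite !inE memvf /= => vW; rewrite /covers addvSl /= dim_addv_line.
Qed.

Lemma dim_eq_full V : (\dim V == n) = (V == fullv).
Proof. by rewrite eqEdim subvf dim_fullv eqn_leq dim_le. Qed.

Lemma inj_leq_card (T : finType) (f : T -> T) (A B : {pred T}) :
  injective f -> (forall x, x \in A -> f x \in B) -> (#|A| <= #|B|)%N.
Proof.
move=> f_inj fAB; rewrite -(card_imset A f_inj); apply: subset_leq_card.
by apply/subsetP => _ /imsetP[x xA ->]; apply: fAB.
Qed.

Section LinearImage.
Variables (g : 'End('rV[F]_n)) (g0 : lker g == 0%VS).

Lemma limg_inj : injective (fun U : G => (g @: U)%VS).
Proof.
by move=> U V /eqP; rewrite eqEsubv !limg_ker0 // => e; apply/eqP; rewrite eqEsubv.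
Qed.

Lemma dim_limg U : \dim (g @: U) = \dim U.
Proof. by rewrite limg_dim_eq // (eqP g0) capv0. Qed.

Lemma covers_limg W V : covers (g @: W)%VS (g @: V)%VS = covers W V.
Proof. by rewrite /covers limg_ker0 // !dim_limg. Qed.

End LinearImage.

End Subspaces.

(** * Quantum integers *)

Section QIntegers.
Variables (R : realFieldType) (q : R).

Definition qint m : R := \sum_(i < m) q ^+ i.

Lemma qint0 : qint 0 = 0.
Proof. by rewrite /qint big_ord0. Qed.

Lemma qintS m : qint m.+1 = 1 + q * qint m.
Proof.
rewrite /qint big_ord_recl expr0 mulr_sumr; congr (_ + _).
by apply: eq_bigr => i _; rewrite -exprS.
Qed.

Lemma qintE m : (q - 1) * qint m = q ^+ m - 1.
Proof. by rewrite /qint subrX1. Qed.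

Lemma qintD a b : qint (a + b) = qint a + q ^+ a * qint b.
Proof.
elim: a => [|a IH]; first by rewrite qint0 expr0 mul1r add0r.
by rewrite addSn !qintS IH exprS; ring.
Qed.

Hypothesis q_gt1 : 1 < q.

Lemma qint_ge0 m : 0 <= qint m.
Proof. by apply: sumr_ge0 => i _; rewrite exprn_ge0 // ltW // (lt_trans ltr01). Qed.

Lemma qint_gt0 m : (0 < m)%N -> 0 < qint m.
Proof.
case: m => // m _; rewrite qintS; apply: ltr_wpDr => //.
by rewrite mulr_ge0 ?qint_ge0 // ltW // (lt_trans ltr01).
Qed.

Lemma qint_lt a b : (a < b)%N -> qint a < qint b.
Proof.
move=> ab; have -> : (b = a + (b - a))%N by lia.
rewrite qintD ltrDl mulr_gt0 ?exprn_gt0 ?qint_gt0 //; last by lia.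
exact: lt_trans ltr01 q_gt1.
Qed.

End QIntegers.

Section LevelProducts.
Variables (R : realFieldType) (q : R) (n : nat).
Notation qint := (qint q).

(** The scalar by which D U acts in dimension i-1 on the constants. *)
Definition level_prod i : R := qint i * qint (n.+1 - i).

Lemma level_prod_diff i : (i <= n)%N -> level_prod i.+1 - level_prod i = qint (n - i) - qint i.
Proof. by move=> le_in; rewrite /level_prod subSS subSn // !qintS; ring. Qed.

Lemma level_prod_sub k i : (k <= i)%N -> (i <= n.+1 - k)%N ->
  level_prod i - level_prod k = q ^+ k * qint (i - k) * qint (n.+1 - k - i).
Proof.
move=> ki ik; rewrite /level_prod.
have [a ia] : exists a, i = (k + a)%N by exists (i - k)%N; lia.
have [b ib] : exists b, (n.+1 = k + a + k + b)%N by exists (n.+1 - k - i)%N; lia.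
rewrite ia ib.
have -> : (k + a + k + b - (k + a) = k + b)%N by lia.
have -> : (k + a + k + b - k = k + (a + b))%N by lia.
have -> : (k + a - k = a)%N by lia.
have -> : (k + (a + b) - (k + a) = b)%N by lia.
have e m : q ^+ m = 1 + (q - 1) * qint m by rewrite qintE; ring.
rewrite !qintD !e; ring.
Qed.

Lemma level_prod_sym i : (i <= n.+1)%N -> level_prod (n.+1 - i) = level_prod i.
Proof. by move=> h; rewrite /level_prod subKn // mulrC. Qed.

End LevelProducts.

(** * The up and down operators and their strings *)

Section UpDown.
Variables (F : finFieldType) (n : nat) (R : realFieldType).
Notation G := {vspace 'rV[F]_n}.
Implicit Types (U V W X Y : G) (f g : G -> R).

Definition fieldq : R := #|F|%:R.
Notation q := fieldq.

Lemma fieldq_gt1 : 1 < q.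
Proof. by rewrite /fieldq ltr1n finNzRing_gt1. Qed.

Notation qi := (qint q).

Lemma card_upper W : #|[set V : G | covers W V]|%:R = qi (n - \dim W).
Proof.
have := congr1 (fun m => m%:R : R) (card_upper_covers W).
have q1 := fieldq_gt1; have q0 : q != 0 by rewrite gt_eqF // (lt_trans ltr01).
have qX m : (#|F| ^ m)%:R = q ^+ m by rewrite natrX.
have lt_q m m' : (m <= m')%N -> (#|F| ^ m <= #|F| ^ m')%N.
  by move=> h; rewrite leq_exp2l // finNzRing_gt1.
rewrite natrM !natrB ?lt_q ?dim_le // !qX exprS => e.
have qd : q ^+ \dim W != 0 by rewrite expf_neq0.
apply: (mulIf (mulf_neq0 (_ : q - 1 != 0) qd)); first by rewrite subr_eq0 gt_eqF.
transitivity (q ^+ n - q ^+ \dim W); first by rewrite mulrBl mul1r e.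
rewrite mulrA [_ * (q - 1)]mulrC qintE mulrBl mul1r -exprD subnK //.
exact: dim_le.
Qed.

(** Orthogonality reduces lower covers to upper covers. *)
Lemma card_lower V : #|[set W : G | covers W V]|%:R = qi (\dim V).
Proof.
have -> : [set W : G | covers W V] = @perp F n @: [set V' : G | covers (perp V) V'].
  apply/setP => W; rewrite -{2}(perpK W) mem_imset; last exact: (can_inj (@perpK F n)).
  by rewrite !inE covers_perp.
rewrite card_imset; last exact: (can_inj (@perpK F n)).
by rewrite card_upper dim_perp subKn // dim_le.
Qed.

Definition Up f V := \sum_(W | covers W V) f W.
Definition Down f W := \sum_(V | covers W V) f V.

Let meet_level X Y := (\dim X == \dim Y) && (\dim (X + Y) == (\dim X).+1).

(** Two distinct subspaces of equal dimension have at most one common upper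
    cover, their sum, and at most one common lower cover, their
    intersection; by the dimension formula they have one exactly when they
    have the other.  So the off-diagonal entries of D U and U D agree. *)
Let common_upper X Y V : X != Y ->
  covers X V && covers Y V = (V == X + Y)%VS && meet_level X Y.
Proof.
move=> XY; apply/andP/andP => [[/andP[XV /eqP dX] /andP[YV /eqP dY]]|[/eqP-> /andP[/eqP d /eqP e]]].
  have sV : (X + Y <= V)%VS by rewrite subv_add XV.
  have d : \dim X = \dim Y by move: dX; rewrite dY => -[].
  have h : (\dim X < \dim (X + Y))%N.
    rewrite ltnNge; apply: contra XY => le.
    have /eqP E : X == (X + Y)%VS by rewrite eqEdim addvSl.
    by rewrite eq_sym eqEdim d leqnn andbT E addvSr.
  have E : (X + Y)%VS = V by apply/eqP; rewrite eqEdim sV dX.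
  by rewrite E eqxx /meet_level d eqxx /= E dX d.
by rewrite /covers addvSl addvSr e -d eqxx.
Qed.

Let common_lower X Y W : X != Y ->
  covers W X && covers W Y = (W == X :&: Y)%VS && meet_level X Y.
Proof.
have sc := dimv_sum_cap X Y.
move=> XY; apply/andP/andP => [[/andP[WX /eqP dX] /andP[WY /eqP dY]]|[/eqP-> /andP[/eqP d /eqP e]]].
  have sW : (W <= X :&: Y)%VS by rewrite subv_cap WX.
  have d : \dim X = \dim Y by rewrite dX dY.
  have h : (\dim (X :&: Y) < \dim X)%N.
    rewrite ltnNge; apply: contra XY => le.
    have /eqP E : (X :&: Y)%VS == X by rewrite eqEdim capvSl.
    by rewrite eqEdim d leqnn andbT -{1}E capvSr.
  have E : W = (X :&: Y)%VS by apply/eqP; rewrite eqEdim sW -ltnS -dX.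
  rewrite -E eqxx /meet_level d eqxx /=; split=> //; apply/eqP.
  by move: sc; rewrite -E; lia.
by rewrite /covers capvSl capvSr; move: sc; rewrite e -d; split; apply/eqP; lia.
Qed.

Lemma Down_Up f X : Down (Up f) X = Up (Down f) X + (qi (n - \dim X) - qi (\dim X)) * f X.
Proof.
have du : Down (Up f) X = \sum_Y #|[set V : G | covers X V && covers Y V]|%:R * f Y.
  rewrite /Down /Up (exchange_big_dep predT) //=; apply: eq_bigr => Y _.
  by rewrite sumr_const -[LHS]mulr_natl; congr (_%:R * _); apply: eq_card => V; rewrite !inE.
have ud : Up (Down f) X = \sum_Y #|[set W : G | covers W X && covers W Y]|%:R * f Y.
  rewrite /Down /Up (exchange_big_dep predT) //=; apply: eq_bigr => Y _.
  by rewrite sumr_const -[LHS]mulr_natl; congr (_%:R * _); apply: eq_card => V; rewrite !inE.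
rewrite du ud (bigD1 X) //= [in RHS](bigD1 X) //=.
rewrite -card_upper -card_lower.
have -> : [set V : G | covers X V && covers X V] = [set V : G | covers X V].
  by apply/setP => V; rewrite !inE andbb.
have -> : [set V : G | covers V X && covers V X] = [set V : G | covers V X].
  by apply/setP => V; rewrite !inE andbb.
have -> : \sum_(Y | Y != X) #|[set V : G | covers X V && covers Y V]|%:R * f Y =
  \sum_(Y | Y != X) #|[set W : G | covers W X && covers W Y]|%:R * f Y.
  apply: eq_bigr => Y; rewrite eq_sym => XY; congr (_%:R * _).
  case C: (meet_level X Y).
    have eU : #|[set V : G | covers X V & covers Y V]| = #|[set (X + Y)%VS]|.
      by apply: eq_card => V; rewrite !inE common_upper // C andbT.
    have eL : #|[set W : G | covers W X & covers W Y]| = #|[set (X :&: Y)%VS]|.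
      by apply: eq_card => W; rewrite !inE common_lower // C andbT.
    by rewrite eU eL !cards1.
  by apply: eq_card => V; rewrite !inE common_upper ?common_lower // C !andbF.
ring.
Qed.

Lemma Up_Down_adjoint f g i :
  \sum_(V | \dim V == i.+1) Up f V * g V = \sum_(W | \dim W == i) f W * Down g W.
Proof.
under eq_bigr do rewrite /Up big_distrl /=.
under [RHS]eq_bigr do rewrite /Down big_distrr /=.
rewrite (exchange_big_dep (fun W => \dim W == i)) /=; last first.
  by move=> V W /eqP dV /andP[_]; rewrite dV eqSS eq_sym.
apply: eq_bigr => W /eqP dW; apply: eq_bigl => V.
by rewrite /covers dW; case: (_ == i.+1); rewrite ?andbF.
Qed.

(** The string generated by a function killed by D in dimension k, all its
    levels being gathered in the single function f on subspaces. *)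
Definition is_string k f :=
  [/\ forall V, (\dim V < k)%N -> f V = 0,
      forall V, (k < \dim V)%N -> Up f V = f V
    & forall W, (\dim W).+1 = k -> Down f W = 0].

Notation h := (level_prod q n).

(** Induction on the dimension: D f = D U f = U D f + ([n-d] - [d]) f, and
    level_prod telescopes these differences. *)
Lemma string_Down k f : is_string k f -> forall V, (k <= \dim V)%N ->
  Down f V = (h (\dim V).+1 - h k) * f V.
Proof.
move=> [f0 fU fD] V; have [d dE] := ubnP (\dim V).
elim: d V dE => // d IH V; rewrite ltnS => Vd kV.
have -> : Down f V = Down (Up f) V.
  by apply: eq_bigr => W /andP[_ /eqP dW]; rewrite fU // dW ltnS.
rewrite Down_Up -level_prod_diff ?dim_le //.
suff -> : Up (Down f) V = (h (\dim V) - h k) * f V by ring.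
move: kV; rewrite leq_eqVlt => /orP[/eqP kV|kV].
  rewrite kV subrr mul0r /Up big1 // => W /andP[_ /eqP dW]; apply: fD.
  by rewrite kV.
rewrite -fU // /Up mulr_sumr; apply: eq_bigr => W /andP[_ /eqP dW].
rewrite IH; [by rewrite dW | by rewrite dW in Vd | by rewrite dW ltnS in kV].
Qed.

Lemma sum_sqr_eq0 f i : \sum_(V | \dim V == i) f V * f V <= 0 ->
  forall V, \dim V = i -> f V = 0.
Proof.
move=> le0 V dV; apply/eqP; rewrite -sqrf_eq0 expr2; move: le0; rewrite le_eqVlt.
have ge0 : 0 <= \sum_(V | \dim V == i) f V * f V.
  by apply: sumr_ge0 => W _; rewrite -expr2 sqr_ge0.
rewrite ltNge ge0 orbF psumr_eq0 => [/allP h|W _]; last by rewrite -expr2 sqr_ge0.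
by have := h V (mem_index_enum _); rewrite dV eqxx.
Qed.

Lemma string_vanish_above k f j : is_string k f -> (k <= j)%N ->
  (forall V, \dim V = j -> f V = 0) -> forall V, (j <= \dim V)%N -> f V = 0.
Proof.
move=> [_ fU _] kj fj V; have [d dE] := ubnP (\dim V).
elim: d V dE => // d IH V; rewrite ltnS => Vd.
rewrite leq_eqVlt => /orP[/eqP/esym|jV]; first exact: fj.
rewrite -fU ?(leq_ltn_trans kj) // /Up big1 // => W /andP[_ /eqP dW].
by apply: IH; [rewrite dW in Vd | rewrite dW ltnS in jV].
Qed.

(** For k > n/2 the identity |U f|^2 = <f, D U f> expresses a square as a
    negative multiple of |f|^2. *)
Lemma string_big k f : is_string k f -> (n < 2 * k)%N -> forall V, f V = 0.
Proof.
move=> sf nk V; have [f0 fU fD] := sf.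
have [kV|] := leqP k (\dim V); last exact: f0.
have kn : (k <= n)%N by apply: leq_trans (dim_le V).
apply: (string_vanish_above sf (leqnn k)) => //; apply: sum_sqr_eq0.
have e := Up_Down_adjoint f f k.
have e1 : \sum_(V | \dim V == k.+1) Up f V * f V = \sum_(V | \dim V == k.+1) f V * f V.
  by apply: eq_bigr => W /eqP dW; rewrite fU // dW.
have e2 : \sum_(W | \dim W == k) f W * Down f W =
  (qi (n - k) - qi k) * \sum_(W | \dim W == k) f W * f W.
  rewrite mulr_sumr; apply: eq_bigr => W /eqP dW.
  by rewrite (string_Down sf) dW // level_prod_diff // mulrCA.
move: e; rewrite e1 e2.
have lt : qi (n - k) - qi k < 0 by rewrite subr_lt0 qint_lt ?fieldq_gt1 //; lia.
have : 0 <= \sum_(V | \dim V == k.+1) f V * f V.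
  by apply: sumr_ge0 => W _; rewrite -expr2 sqr_ge0.
by move=> p E; rewrite E nmulr_rge0 in p.
Qed.

(** The scalar of string_Down vanishes between dimensions n-k and n-k+1,
    where |U f|^2 = <f, D U f> = 0. *)
Lemma string_high k f : is_string k f -> forall V, (n - k < \dim V)%N -> f V = 0.
Proof.
move=> sf V kV; have [nk|nk] := ltnP n (2 * k); first exact: (string_big sf nk).
have [f0 fU fD] := sf.
apply: (string_vanish_above (j := (n - k).+1) sf) => //; first by lia.
apply: sum_sqr_eq0; have e := Up_Down_adjoint f f (n - k).
have e1 : \sum_(V | \dim V == (n - k).+1) Up f V * f V =
    \sum_(V | \dim V == (n - k).+1) f V * f V.
  by apply: eq_bigr => W /eqP dW; rewrite fU // dW; lia.
rewrite -e1 e big1 // => W /eqP dW.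
rewrite (string_Down sf) dW; last by lia.
have -> : ((n - k).+1 = n.+1 - k)%N by lia.
by rewrite level_prod_sym ?subrr ?mul0r ?mulr0 //; lia.
Qed.

Lemma string_of k s : (forall W, (\dim W).+1 = k -> Down s W = 0) ->
  exists2 f, is_string k f & forall V, \dim V = k -> f V = s V.
Proof.
move=> s0; exists (fun V => if (\dim V < k)%N then 0 else iter (\dim V - k) Up s V).
  split=> [V -> //|V kV|W dW].
    rewrite ltnNge ltnW //= -[(\dim V - k)%N]prednK ?subn_gt0 // iterS.
    apply: eq_bigr => W /andP[_ /eqP dW]; rewrite dW in kV *.
    by rewrite ltnNge -ltnS kV /= subSn // -ltnS.
  rewrite -(s0 W dW); apply: eq_bigr => V /andP[_ /eqP ->].
  by rewrite dW ltnn subnn.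
by move=> V ->; rewrite ltnn subnn.
Qed.

(** A function orthogonal to the image of U is killed by D, hence starts a
    string of its own, to which it is orthogonal only if it is 0. *)
Lemma strings_span i f :
  (forall k g, is_string k g -> \sum_(V | \dim V == i) f V * g V = 0) ->
  forall V, \dim V = i -> f V = 0.
Proof.
elim: i f => [|i IH] f orth.
  have [|g sg gf] := @string_of 0 f; first by [].
  apply: sum_sqr_eq0; rewrite le_eqVlt; apply/orP; left; apply/eqP; apply: etrans (orth _ _ sg).
  by apply: eq_bigr => V /eqP dV; rewrite gf.
have D0 W : (\dim W).+1 = i.+1 -> Down f W = 0.
  move=> [dW]; apply: IH dW => k g sg.
  rewrite (eq_bigr (fun W => g W * Down f W)) => [|X _]; last by rewrite mulrC.
  rewrite -Up_Down_adjoint; have [g0 gU gD] := sg.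
  have [ki|ik] := leqP k i.
    apply: etrans (orth _ _ sg); apply: eq_bigr => V /eqP dV.
    by rewrite mulrC gU // dV.
  rewrite big1 // => V /eqP dV; rewrite /Up big1 ?mul0r // => X /andP[_ /eqP dX].
  by apply: g0; move: dX; rewrite dV => -[<-].
have [g sg gf] := string_of D0.
apply: sum_sqr_eq0; rewrite le_eqVlt; apply/orP; left; apply/eqP; apply: etrans (orth _ _ sg).
by apply: eq_bigr => V /eqP dV; rewrite gf.
Qed.

End UpDown.

Section StringExistence.
Variables (F : finFieldType) (n : nat) (R : realFieldType).
Notation G := {vspace 'rV[F]_n}.
Notation qi := (qint (fieldq F R)).

Lemma underdetermined_system (K : fieldType) (T : finType) (A B : {set T})
    (m : T -> T -> K) : (#|B| < #|A|)%N ->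
  exists s : T -> K, (exists2 a, a \in A & s a != 0) /\
    forall b, b \in B -> \sum_(a in A) s a * m a b = 0.
Proof.
move=> BA; pose M : 'M[K]_(#|A|, #|B|) := \matrix_(i, j) m (enum_val i) (enum_val j).
have /rowV0Pn[v /sub_kermxP vM v0] : kermx M != 0.
  by rewrite kermx_eq0 /row_free neq_ltn (leq_ltn_trans (rank_leq_col M) BA).
pose s a := \sum_(i | enum_val i == a :> T) v 0 i.
have sE (i : 'I_#|A|) : s (enum_val i) = v 0 i.
  by rewrite /s (eq_bigl (pred1 i)) ?big_pred1_eq // => j; rewrite /= (inj_eq enum_val_inj).
exists s; split.
  have [i vi] : exists i, v 0 i != 0.
    apply/existsP; apply: contraNT v0; rewrite negb_exists => /forallP h.
    by apply/eqP/rowP => i; rewrite mxE; apply/eqP; have := h i; rewrite negbK.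
  by exists (enum_val i); [apply: enum_valP | rewrite sE].
move=> b bB; have := congr1 (fun w : 'rV_#|B| => w 0 (enum_rank_in bB b)) vM.
rewrite !mxE => e; rewrite -[RHS]e big_enum_val; apply: eq_bigr => i _.
by rewrite sE mxE enum_rankK_in.
Qed.

(** Double counting of the covering pairs between the two levels:
    [k] times one cardinal is [n-k+1] times the other. *)
Lemma card_level_lt k : (0 < k)%N -> (2 * k <= n)%N ->
  (#|[set V : G | \dim V == k.-1]| < #|[set V : G | \dim V == k]|)%N.
Proof.
move=> k0 kn.
have := @Up_Down_adjoint F n R (fun=> 1) (fun=> 1) k.-1; rewrite prednK //.
have cst (i : nat) (c : R) (f : G -> R) : (forall V : G, \dim V = i -> f V = c) ->
    \sum_(V : G | \dim V == i) f V = #|[set V : G | \dim V == i]|%:R * c.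
  move=> fc; rewrite (eq_bigr (fun=> c)) => [|V /eqP /fc //].
  by rewrite sumr_const mulr_natl; congr (_ *+ _); apply: eq_card => V; rewrite !inE.
rewrite (@cst k (qi k)); last first.
  move=> V dV; rewrite mulr1 -dV -card_lower /Up sumr_const.
  by congr (_%:R); apply: eq_card => W; rewrite !inE.
rewrite (@cst k.-1 (qi (n - k.-1))); last first.
  move=> V dV; rewrite mul1r -dV -card_upper /Down sumr_const.
  by congr (_%:R); apply: eq_card => W; rewrite !inE.
have q1 := fieldq_gt1 F R.
have lt : qi k < qi (n - k.-1) by apply: qint_lt => //; lia.
have k_gt0 : 0 < qi k by apply: qint_gt0.
set a := #|_|; set b := #|_| => e.
have [a0|a_gt0] := posnP a.
  have : (0 < b)%N.
    apply/card_gt0P.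
    exists <<take k.-1 (vbasis (fullv : G))>>%VS; rewrite inE.
    have : free (take k.-1 (vbasis (fullv : G))).
      by have := basis_free (vbasisP (fullv : G));
        rewrite -{1}(cat_take_drop k.-1 (vbasis (fullv : G))) => /catl_free.
    move/eqP->; rewrite size_takel // size_tuple dim_fullv; lia.
  move=> b0; move: e; rewrite a0 mul0r => /esym/eqP.
  by rewrite mulf_eq0 pnatr_eq0 (gtn_eqF b0) gt_eqF // (lt_trans k_gt0).
rewrite -(ltr_nat R) -(ltr_pM2r k_gt0) e.
have a_gt0R : 0 < a%:R :> R by rewrite ltr0n.
have [b0|b_gt0] := posnP b.
  by move: e; rewrite b0 mul0r => /eqP; rewrite mulf_eq0 !gt_eqF.
by rewrite ltr_pM2l // ltr0n.
Qed.

(** D maps functions in dimension k to functions in dimension k-1, a space of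
    smaller dimension. *)
Lemma string_exists k : (0 < k)%N -> (2 * k <= n)%N ->
  exists2 f : G -> R, is_string k f & exists2 V, \dim V = k & f V != 0.
Proof.
move=> k0 kn.
have [s [[V Vk sV] s0]] :=
  underdetermined_system (fun V W : G => (covers W V)%:R : R) (card_level_lt k0 kn).
have [|f sf fs] := @string_of F n R k s.
  move=> W dW; have := s0 W; rewrite inE -dW eqxx => /(_ isT) e; rewrite -[RHS]e.
  rewrite /Down big_mkcond [RHS]big_mkcond /=; apply: eq_bigr => X _.
  rewrite inE; case: ifP => [C|_]; last by rewrite mulr0 if_same.
  by case/andP: C => _ ->; rewrite mulr1.
by exists f => //; exists V; [|rewrite fs //]; move: Vk; rewrite inE => /eqP.
Qed.

End StringExistence.

(** * Averages over subspaces *)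

Section Averages.
Variables (F : finFieldType) (n : nat) (R : realFieldType).
Notation G := {vspace 'rV[F]_n}.
Implicit Types (U V W X : G) (f g : G -> R) (i : nat).
Notation qi := (qint (fieldq F R)).

Definition sub_level i V U := (U <= V)%VS && (\dim U == i).

Lemma sub_level_exists i V : (i <= \dim V)%N -> exists U, sub_level i V U.
Proof.
move=> iV; have fV := basis_free (vbasisP V).
exists <<take i (vbasis V)>>%VS; apply/andP; split.
  by apply/span_subvP => v /mem_take /vbasis_mem.
have : free (take i (vbasis V)).
  by move: fV; rewrite -{1}(cat_take_drop i (vbasis V)) => /catl_free.
by move/eqP->; rewrite size_takel // size_tuple.
Qed.

Let card_le i V V' : \dim V = \dim V' -> (#|sub_level i V| <= #|sub_level i V'|)%N.
Proof.
move=> dV; have [g [g0 _ gV]] := flag_transitive (subvv V) (subvv V') dV dV.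
apply: inj_leq_card (limg_inj g0) _ => U /andP[UV dU].
by rewrite unfold_in /sub_level -gV limg_ker0 // UV dim_limg.
Qed.

Lemma card_sub_level_eq i V V' : \dim V = \dim V' -> #|sub_level i V| = #|sub_level i V'|.
Proof. by move=> dV; apply/eqP; rewrite eqn_leq !card_le. Qed.

(** By transitivity the number of these W depends on dimensions only. *)
Let between V U W := (U <= W)%VS && covers W V.

Let between_le V U U' : (U <= V)%VS -> (U' <= V)%VS -> \dim U = \dim U' ->
  (#|between V U| <= #|between V U'|)%N.
Proof.
move=> UV UV' dU; have [g [g0 gU gV]] := flag_transitive UV UV' dU erefl.
apply: inj_leq_card (limg_inj g0) _ => W /andP[UW WV].
by rewrite unfold_in /between -gU -gV limg_ker0 // UW covers_limg.
Qed.

Let card_between_eq V U U' : (U <= V)%VS -> (U' <= V)%VS -> \dim U = \dim U' ->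
  #|between V U| = #|between V U'|.
Proof. by move=> UV UV' dU; apply/eqP; rewrite eqn_leq !between_le. Qed.

Definition avg i f V := (\sum_(U | sub_level i V U) f U) / #|sub_level i V|%:R.

Lemma avg_self f V : avg (\dim V) f V = f V.
Proof.
have e : sub_level (\dim V) V =1 pred1 V.
  move=> U; rewrite /sub_level /=; apply/andP/eqP => [[UV /eqP dU]|->].
    by apply/eqP; rewrite eqEdim UV dU leqnn.
  by rewrite subvv eqxx.
by rewrite /avg (eq_bigl _ _ e) big_pred1_eq (eq_card e) card1 divr1.
Qed.

(** Averaging over the hyperplanes of V the averages over their subspaces
    counts every subspace of V of dimension i the same number of times; the
    normalization is fixed by the constant function 1. *)
Lemma avg_tower i f V : (i < \dim V)%N ->
  avg i f V = (qi (\dim V))^-1 * Up (avg i f) V.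
Proof.
move=> iV; have [U0 /andP[U0V /eqP dU0]] := sub_level_exists (ltnW iV).
have [W0 /andP[W0V /eqP dW0]] : exists W, sub_level (\dim V).-1 V W.
  by apply: sub_level_exists; rewrite leq_pred.
pose c := #|sub_level i W0|; pose m := #|between V U0|.
have V0 : (0 < \dim V)%N by apply: leq_ltn_trans iV.
have c_gt0 : (0 < c)%N.
  have [|U hU] := @sub_level_exists i W0; first by rewrite dW0 -ltnS prednK.
  by apply/card_gt0P; exists U.
have UpE h : Up (fun W => (\sum_(U | sub_level i W U) h U) / c%:R) V
    = m%:R / c%:R * \sum_(U | sub_level i V U) h U.
  rewrite /Up -mulr_suml mulrAC; congr (_ / _).
  rewrite (exchange_big_dep (sub_level i V)) /=; last first.
    by move=> W U /andP[WV _] /andP[UW dU]; rewrite /sub_level dU (subv_trans UW).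
  rewrite mulr_sumr; apply: eq_bigr => U /andP[UV /eqP dU].
  rewrite sumr_const -[LHS]mulr_natl; congr (_%:R * _).
  rewrite /m (card_between_eq U0V UV) ?dU //; apply: eq_card => W.
  by rewrite !unfold_in /between /sub_level dU eqxx andbT andbC.
have avgE h : Up (avg i h) V = m%:R / c%:R * \sum_(U | sub_level i V U) h U.
  rewrite -UpE; apply: eq_bigr => W /andP[WV /eqP dW].
  by rewrite /avg (card_sub_level_eq i (V' := W0)) // dW0 dW.
have N0 : (#|sub_level i V|%:R : R) != 0.
  rewrite pnatr_eq0 -lt0n; apply/card_gt0P; exists U0.
  by rewrite unfold_in /sub_level U0V dU0 eqxx.
have qE : qi (\dim V) = m%:R / c%:R * #|sub_level i V|%:R.
  have := avgE (fun=> 1); rewrite sumr_const => <-.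
  rewrite -card_lower -sum1_card natr_sum; apply: eq_big => [W|W]; rewrite inE //.
  move=> /andP[WV /eqP dW].
  have -> : avg i (fun=> 1) W = c%:R / c%:R.
    rewrite /avg sumr_const (card_sub_level_eq i (V' := W0)) ?dW0 ?dW //.
  by rewrite divff // pnatr_eq0 -lt0n.
have q0 : qi (\dim V) != 0 by rewrite gt_eqF // qint_gt0 // fieldq_gt1.
rewrite avgE; apply: (mulfI q0); rewrite mulVKf // {1}qE /avg.
by rewrite -!mulrA; congr (_ * (_ * _)); rewrite mulrCA divff // mulr1.
Qed.

Definition below f V := \sum_(i < \dim V) avg i f V.

Lemma below_rec f V :
  below f V = (qi (\dim V))^-1 * Up (fun W => below f W + f W) V.
Proof.
have -> : below f V = \sum_(i < \dim V) (qi (\dim V))^-1 * Up (avg i f) V.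
  by apply: eq_bigr => i _; apply: avg_tower.
rewrite -mulr_sumr.
congr (_ * _); rewrite /Up exchange_big /=; apply: eq_bigr => W /andP[_ /eqP dW].
by rewrite dW big_ord_recr /= avg_self.
Qed.

Definition above f V := below (f \o @perp F n) (perp V).

Lemma above_rec f V :
  above f V = (qi (n - \dim V))^-1 * Down (fun W => above f W + f W) V.
Proof.
rewrite /above below_rec dim_perp; congr (_ * _).
rewrite /Up /Down (reindex_inj (can_inj (@perpK F n))) /=.
by apply: eq_big => [W|W _]; rewrite ?covers_perp // perpK.
Qed.

End Averages.

(** * The Laplacian in terms of averages *)

Section LaplacianFormula.
Variables (F : finFieldType) (n : nat).
Notation G := {vspace 'rV[F]_n}.
Notation vtx := (vertex F n).
Implicit Types (U V W : vtx) (t : {set vtx}).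

Definition vdim V := \dim (val V).

Lemma nontrivialP (U : G) : nontrivial U = (0 < \dim U < n)%N.
Proof.
by rewrite /nontrivial lt0n dimv_eq0 ltn_neqAle dim_le andbT dim_eq_full.
Qed.

Lemma vdim_gt0 V : (0 < vdim V)%N.
Proof. by have := valP V; rewrite nontrivialP => /andP[]. Qed.

Lemma vdim_lt V : (vdim V < n)%N.
Proof. by have := valP V; rewrite nontrivialP => /andP[]. Qed.

Definition comparable U V := (val U <= val V)%VS || (val V <= val U)%VS.

Lemma flag_comparable t U V : complete_flag t -> U \in t -> V \in t -> comparable U V.
Proof. by case/andP=> /forall_inP h _ Ut Vt; apply: (forall_inP (h _ Ut)). Qed.

Lemma comparable_dim_eq U V : comparable U V -> vdim U = vdim V -> U = V.
Proof.
move=> /orP[] h e; apply: val_inj; apply/eqP; last rewrite eq_sym;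
by rewrite eqEdim h -!/(vdim _) e leqnn.
Qed.

(** The dimension is injective on a chain, and n-1 dimensions are
    available for n-1 members. *)
Lemma complete_flag_level t i : complete_flag t -> (0 < i < n)%N ->
  #|[set U in t | vdim U == i]| = 1%N.
Proof.
move=> ct /andP[i0 iN].
have lt U : ((vdim U).-1 < n.-1)%N by have := vdim_gt0 U; have := vdim_lt U; lia.
pose p U := Ordinal (lt U).
have p_inj : {in t &, injective p}.
  move=> U V Ut Vt /(congr1 val) /= e; apply: comparable_dim_eq.
    exact: flag_comparable Ut Vt.
  by have := vdim_gt0 U; have := vdim_gt0 V; lia.
have full : p @: t = setT.
  apply/eqP; rewrite eqEcard subsetT /= cardsT card_ord card_in_imset //.
  by case/andP: ct => _ /eqP->.
have iN' : (i.-1 < n.-1)%N by lia.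
have /imsetP[U Ut /(congr1 val) /= eU] : Ordinal iN' \in p @: t by rewrite full.
have dU : vdim U = i by have := vdim_gt0 U; lia.
apply: etrans _ (cards1 U); apply: eq_card => V; rewrite !inE; apply/andP/eqP => [[Vt /eqP dV]|->].
  by apply: comparable_dim_eq (flag_comparable ct Vt Ut) _; rewrite dV.
by rewrite Ut dU eqxx.
Qed.

Lemma weight_level V i : (0 < i < n)%N ->
  (\sum_(U | comparable U V && (vdim U == i)) weight [set U; V] = weight [set V])%N.
Proof.
move=> hi; rewrite /weight.
under eq_bigr do rewrite -sum1_card.
rewrite (exchange_big_dep (mem [set t : {set vtx} | complete_flag t && ([set V] \subset t)])) /=.
  rewrite -sum1_card; apply: eq_bigr => t; rewrite inE sub1set => /andP[ct Vt].
  rewrite sum1_card; apply: etrans _ (complete_flag_level ct hi); apply: eq_card => U.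
  rewrite !inE unfold_in /= inE ct subUset !sub1set Vt andbT andbC.
  by case Ut: (U \in t) => //=; rewrite (flag_comparable ct Ut Vt).
move=> U t _; rewrite !inE subUset !sub1set => /andP[-> /andP[_ ->]] //.
Qed.

Section Automorphism.
Variables (g : 'End('rV[F]_n)) (g0 : lker g == 0%VS).

Let img_nontrivial V : nontrivial (g @: val V)%VS.
Proof. by rewrite nontrivialP dim_limg // -nontrivialP (valP V). Qed.

Definition vimg V : vtx := Sub (g @: val V)%VS (img_nontrivial V).

Lemma vimg_inj : injective vimg.
Proof. by move=> U V /(congr1 val) /= /(limg_inj g0) /val_inj. Qed.

Lemma vimg_complete t : complete_flag t -> complete_flag (vimg @: t).
Proof.
move=> /andP[/forall_inP h /eqP ct]; apply/andP; split; last first.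
  by rewrite card_imset ?ct //; apply: vimg_inj.
apply/forall_inP => _ /imsetP[U Ut ->]; apply/forall_inP => _ /imsetP[V Vt ->] /=.
by rewrite !limg_ker0 //; apply: (forall_inP (h _ Ut)).
Qed.

(** Linear automorphisms map complete flags injectively to complete flags;
    equality of the weights of two pairs then follows by symmetry. *)
Lemma weight_le_vimg (s : {set vtx}) : (weight s <= weight (vimg @: s))%N.
Proof.
apply: (inj_leq_card (f := fun t : {set vtx} => vimg @: t)).
  exact: imset_inj vimg_inj.
move=> t; rewrite !inE => /andP[ct st]; rewrite vimg_complete //=.
exact: imsetS.
Qed.

End Automorphism.

Let weight_pair_le U U' V : comparable U V -> comparable U' V ->
  vdim U = vdim U' -> (weight [set U; V] <= weight [set U'; V])%N.
Proof.
move=> cU cU' dU.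
suff [g [g0 gU gV]] : exists g : 'End('rV[F]_n),
    [/\ lker g == 0%VS, (g @: val U)%VS = val U' & (g @: val V)%VS = val V].
  have -> : [set U'; V] = vimg g0 @: [set U; V].
    rewrite imsetU !imset_set1; congr ([set _] :|: [set _]); apply: val_inj => //=.
  exact: weight_le_vimg.
have [dV|dV] := leqP (vdim V) (vdim U).
  have up W : comparable W V -> (vdim V <= vdim W)%N -> (val V <= val W)%VS.
    case/orP=> // h le; suff -> : val W = val V by [].
    by apply/eqP; rewrite eqEdim h.
  have [||g [g0 gV gU]] := @flag_transitive F n (val V) (val U) (val V) (val U') _ _ erefl dU.
  - exact: up.
  - by apply: up; rewrite // -dU.
  by exists g.
have dn W : comparable W V -> (vdim W < vdim V)%N -> (val W <= val V)%VS.
  by case/orP=> // /dimvS; rewrite leqNgt => /negP h /h.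
have [||g [g0 gU gV]] := @flag_transitive F n (val U) (val V) (val U') (val V) _ _ dU erefl.
- exact: dn.
- by apply: dn; rewrite // -dU.
by exists g.
Qed.

Lemma weight_pair_eq U U' V : comparable U V -> comparable U' V ->
  vdim U = vdim U' -> weight [set U; V] = weight [set U'; V].
Proof. by move=> cU cU' dU; apply/eqP; rewrite eqn_leq !weight_pair_le. Qed.

Variable R : realType.
Implicit Types phi : C0 F n R.

(** The weights of the edges from V to a given dimension are equal by
    transitivity, and they add up to the weight of V because a complete flag
    through V has one member in that dimension. *)
Lemma level_mean phi V i (A : pred vtx) : (0 < i < n)%N ->
  (forall U, A U = comparable U V && (vdim U == i)) ->
  \sum_(U | A U) (weight [set U; V])%:R * (phi V - phi U) =
  (weight [set V])%:R * (phi V - (\sum_(U | A U) phi U) / #|A|%:R).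
Proof.
move=> hi AE; have wV := weight_level V hi.
have wA : (\sum_(U | A U) weight [set U; V] = weight [set V])%N.
  by rewrite -wV; apply: eq_bigl.
have [U0 AU0] : exists U0, A U0.
  apply/existsP; apply: contraTT (weight_vertex_gt0 V); rewrite negb_exists => /forallP h.
  by rewrite -wA big_pred0 // => U; apply: negbTE.
have wE U : A U -> weight [set U; V] = weight [set U0; V].
  move: AU0; rewrite !AE => /andP[c0 /eqP d0] /andP[cU /eqP dU].
  by apply: weight_pair_eq => //; rewrite dU.
have c0 : (#|A|%:R : R) != 0 by rewrite pnatr_eq0 -lt0n; apply/card_gt0P; exists U0.
have -> : (weight [set V])%:R = #|A|%:R * (weight [set U0; V])%:R :> R.
  rewrite -wA -natrM; congr (_%:R).
  by rewrite -sum_nat_const; apply: eq_bigr => U /wE.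
rewrite (eq_bigr (fun U => (weight [set U0; V])%:R * (phi V - phi U))) => [|U /wE -> //].
rewrite -mulr_sumr sumrB sumr_const -mulr_natl; field.
exact: c0.
Qed.

(** Extending by 0 to the two trivial subspaces lets the recursions of below
    and above run through all dimensions. *)
Definition extend phi (U : G) : R := if insub U is Some V then phi V else 0.

Lemma extendE phi V : extend phi (val V) = phi V.
Proof. by rewrite /extend valK. Qed.

Lemma extend0 phi (U : G) : ~~ (0 < \dim U < n)%N -> extend phi U = 0.
Proof. by rewrite -nontrivialP /extend => h; rewrite insubN. Qed.

Lemma sum_extend phi (P : pred G) : (forall U : G, P U -> nontrivial U) ->
  \sum_(U : G | P U) extend phi U = \sum_(V : vtx | P (val V)) phi V.
Proof.
move=> Pn; rewrite [RHS](eq_bigr (fun V => extend phi (val V))) => [|V _]; last by rewrite extendE.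
rewrite -(big_sub_cond (@nontrivial F n) P (extend phi)).
by apply: eq_bigl => U; apply/idP/andP => [PU|[]//]; split=> //; exact: Pn.
Qed.

Lemma card_vertices (P : pred G) : (forall U : G, P U -> nontrivial U) ->
  #|[pred V : vtx | P (val V)]| = #|P|.
Proof.
move=> Pn; rewrite -!sum1_card.
rewrite -(big_sub_cond (@nontrivial F n) P (fun=> 1%N)).
by apply: eq_bigl => U; apply/andP/idP => [[]//|PU]; split=> //; exact: Pn.
Qed.

(** Only the edges at V contribute, and the two orders of an edge are
    matched by the sign of its coboundary. *)
Lemma inner1_delta phi V :
  inner1 (d0 (delta R V)) (d0 phi) =
  \sum_(U | (U != V) && comparable U V) (weight [set U; V])%:R * (phi V - phi U).
Proof.
pose E (p : vtx * vtx) := (val p.1 <= val p.2)%VS.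
pose h (p : vtx * vtx) : R := (weight [set p.1; p.2])%:R *
  (delta R V p.2 - delta R V p.1) * (phi p.2 - phi p.1).
have -> : inner1 (d0 (delta R V)) (d0 phi) = \sum_(p in @is_edge F n | E p) h p.
  by rewrite big_sub_cond; apply: eq_bigr => e _; rewrite !ffunE /h !deltaE.
have edgeE p : (p \in @is_edge F n) && E p = (p.1 != p.2) && E p.
  rewrite unfold_in /is_edge; case Ep: (E p); rewrite ?andbF ?andbT //.
  case: (_ != _) => //=; apply/forall_inP => U; rewrite !inE => hU.
  apply/forall_inP => W; rewrite !inE => hW; rewrite /E in Ep.
  by case/orP: hU => /eqP->; case/orP: hW => /eqP->; rewrite ?subvv ?Ep ?orbT.
have -> : \sum_(p in @is_edge F n | E p) h p = \sum_(p | (p.1 != p.2) && E p) h p.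
  exact: eq_bigl.
have -> : \sum_(p | (p.1 != p.2) && E p) h p =
    \sum_U \sum_(W | (U != W) && (val U <= val W)%VS) h (U, W).
  under [RHS]eq_bigr do rewrite big_mkcond /=.
  by rewrite [RHS]pair_bigA big_mkcond /=; apply: eq_bigr => p _; rewrite -surjective_pairing.
pose a U W := (weight [set U; W])%:R * (phi W - phi U).
have hE U W : h (U, W) = delta R V W * a U W - delta R V U * a U W.
  by rewrite /h /a /=; ring.
under eq_bigr do under eq_bigr do rewrite hE.
under eq_bigr do rewrite sumrB.
rewrite sumrB.
have -> : \sum_U \sum_(W | (U != W) && (val U <= val W)%VS) delta R V W * a U W
  = \sum_(U | (U != V) && (val U <= val V)%VS) a U V.
  rewrite [RHS]big_mkcond; apply: eq_bigr => U _.
  rewrite big_mkcond (bigD1 V) //= big1 => [|W WV]; last first.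
    by rewrite deltaE (negPf WV) mul0r if_same.
  by rewrite addr0 deltaE eqxx mul1r.
have -> : \sum_U \sum_(W | (U != W) && (val U <= val W)%VS) delta R V U * a U W
  = \sum_(W | (V != W) && (val V <= val W)%VS) a V W.
  rewrite (bigD1 V) //= [X in _ + X]big1 => [|U UV]; last first.
    by rewrite big1 // => W _; rewrite deltaE (negPf UV) mul0r.
  by rewrite addr0; apply: eq_bigr => W _; rewrite deltaE eqxx mul1r.
rewrite [RHS](bigID (fun U => val U <= val V)%VS) /=; congr (_ + _).
  apply: eq_big => [U|U _]; last by rewrite /a.
  by rewrite /comparable; case: (val U <= val V)%VS; rewrite ?andbF ?andbT.
rewrite -sumrN; apply: eq_big => [U|U _]; last by rewrite /a setUC; ring.
rewrite /comparable eq_sym; case: eqVneq => //= UV.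
case UV1: (val U <= val V)%VS; rewrite ?andbF ?andbT //=.
apply/negP => UV2; case/eqP: UV; apply: val_inj; apply/eqP; by rewrite eqEsubv UV1 UV2.
Qed.

Lemma sum_by_level (T : finType) (P : pred T) (d : T -> nat) m (h : T -> R) :
  (forall x, P x -> (d x < m)%N) ->
  \sum_(x | P x) h x = \sum_(i < m) \sum_(x | P x && (d x == i)) h x.
Proof.
move=> dm; rewrite (exchange_big_dep P) => [|i x _ /andP[] //] /=.
apply: eq_bigr => x Px; rewrite (bigD1 (Ordinal (dm _ Px))) /= ?Px ?eqxx //.
rewrite big1 ?addr0 // => i /andP[/andP[_ /eqP e]] /negP[].
by apply/eqP/val_inj; rewrite /= e.
Qed.

Lemma level_sums phi V (d : vtx -> nat) (A : pred vtx) m (mean : nat -> R) :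
  (0 < m)%N -> mean 0%N = 0 ->
  (forall U, A U -> 0 < d U < m)%N ->
  (forall i, (0 < i < m)%N -> \sum_(U | A U && (d U == i))
     (weight [set U; V])%:R * (phi V - phi U) = (weight [set V])%:R * (phi V - mean i)) ->
  \sum_(U | A U) (weight [set U; V])%:R * (phi V - phi U) =
  (weight [set V])%:R * (m.-1%:R * phi V - \sum_(i < m) mean i).
Proof.
move=> m0 mean0 Ad lev.
rewrite (@sum_by_level _ A d m) => [|U /Ad /andP[] //].
case: m m0 Ad lev => // m _ Ad lev.
rewrite big_ord_recl [X in X + _]big_pred0 => [|U]; last first.
  by apply/negP => /andP[/Ad /andP[d0 _] /eqP e]; rewrite e in d0.
rewrite add0r big_ord_recl mean0 add0r.
rewrite (eq_bigr (fun i : 'I_m => (weight [set V])%:R * (phi V - mean i.+1))).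
  by rewrite -mulr_sumr sumrB sumr_const card_ord -[_ *+ m]mulr_natl.
by move=> i _; rewrite lev //= /bump leq0n add1n ltnS ltn_ord.
Qed.

(** Every dimension other than that of V contributes phi V minus a mean;
    below and above also include the dimensions 0 and n, where phi is 0. *)
Lemma Laplacian_formula phi V :
  Laplacian0 F n R phi V = (n%:R - 1) * phi V
    - (below (extend phi) (val V) + phi V + above (extend phi) (val V)).
Proof.
have w0 := weight_vertex_neq0 R V.
have V0 := vdim_gt0 V; have Vn := vdim_lt V.
rewrite Laplacian0E [LHS]ffunE inner1_delta.
rewrite (bigID (fun U => val U <= val V)%VS) /=.
have lower : \sum_(U | (U != V) && comparable U V && (val U <= val V)%VS)
    (weight [set U; V])%:R * (phi V - phi U) =
    (weight [set V])%:R * ((vdim V).-1%:R * phi V - below (extend phi) (val V)).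
  have ltd U : (U != V) && comparable U V && (val U <= val V)%VS -> (vdim U < vdim V)%N.
    case/andP=> /andP[UV cUV] le; rewrite ltn_neqAle dimvS // andbT.
    by apply: contra UV => /eqP e; apply/eqP/comparable_dim_eq.
  rewrite /below -/(vdim V).
  apply: (@level_sums phi V vdim
    (fun U => (U != V) && comparable U V && (val U <= val V)%VS) (vdim V)
    (fun i => avg i (extend phi) (val V))) => //.
  - rewrite /avg big1 ?mul0r // => U /andP[_ /eqP dU].
    by rewrite extend0 // dU.
  - by move=> U /ltd ->; rewrite vdim_gt0.
  move=> i /andP[i0 iV]; have hi : (0 < i < n)%N by rewrite i0 (ltn_trans iV).
  have selE U : (U != V) && comparable U V && (val U <= val V)%VS && (vdim U == i) =
     sub_level i (val V) (val U).
    apply/andP/andP => [[/andP[_ le] dU] //|[le dU]].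
    rewrite /comparable le dU; split=> //; rewrite !andbT; apply/eqP => UV.
    by rewrite UV in dU; rewrite -(eqP dU) ltnn in iV.
  have selE' U : sub_level i (val V) (val U) = comparable U V && (vdim U == i).
    rewrite /sub_level -/(vdim U); apply: esym.
    apply/andP/andP => [[/orP[//|/dimvS h] dU]|[le dU]]; last first.
      by rewrite /comparable le dU.
    by move: h; rewrite -!/(vdim _) (eqP dU) leqNgt iV.
  rewrite (eq_bigl _ _ selE) (level_mean phi hi selE').
  congr (_ * (_ - _)); rewrite /avg.
  have nt (U : G) : sub_level i (val V) U -> nontrivial U.
    by case/andP=> _ /eqP dU; rewrite nontrivialP dU.
  by rewrite (sum_extend phi nt) -(card_vertices nt).
have upper : \sum_(U | (U != V) && comparable U V && ~~ (val U <= val V)%VS)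
    (weight [set U; V])%:R * (phi V - phi U) =
    (weight [set V])%:R * ((n - vdim V).-1%:R * phi V - above (extend phi) (val V)).
  have gtd U : (U != V) && comparable U V && ~~ (val U <= val V)%VS ->
      (vdim V < vdim U)%N /\ (val V <= val U)%VS.
    case/andP=> /andP[UV cUV] nle; have le : (val V <= val U)%VS.
      by case/orP: cUV => // h; rewrite h in nle.
    split=> //; rewrite ltn_neqAle dimvS // andbT.
    by apply: contra UV => /eqP e; apply/eqP/comparable_dim_eq.
  rewrite /above /below dim_perp -/(vdim V).
  apply: (@level_sums phi V (fun U => (n - vdim U)%N)
    (fun U => (U != V) && comparable U V && ~~ (val U <= val V)%VS) (n - vdim V)
    (fun i => avg i (extend phi \o @perp F n) (perp (val V)))) => //.
  - by rewrite subn_gt0.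
  - rewrite /avg big1 ?mul0r // => U /andP[_ /eqP dU].
    by rewrite /= extend0 // dim_perp dU subn0 ltnn andbF.
  - by move=> U /gtd[lt _]; have := vdim_lt U; rewrite -/(vdim V); lia.
  move=> i /andP[i0 iV]; rewrite -/(vdim V) in iV.
  have hi : (0 < n - i < n)%N by lia.
  have selE U : (U != V) && comparable U V && ~~ (val U <= val V)%VS && (n - vdim U == i)%N =
     sub_level i (perp (val V)) (perp (val U)).
    rewrite /sub_level perp_sub dim_perp -/(vdim U).
    apply/andP/andP => [[h dU]|[le dU]]; first by rewrite dU (gtd U h).2.
    rewrite /comparable le dU orbT; split=> //; rewrite andbT; apply/andP; split.
      by apply/eqP => UV; move: dU; rewrite UV; lia.
    by apply/negP => /dimvS; rewrite -!/(vdim _); lia.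
  have selE' U : sub_level i (perp (val V)) (perp (val U)) =
      comparable U V && (vdim U == (n - i)%N).
    have Un := vdim_lt U.
    rewrite /sub_level perp_sub dim_perp -/(vdim U).
    have -> : (vdim U == (n - i)%N) = ((n - vdim U)%N == i) by apply/eqP/eqP; lia.
    apply: esym; apply/andP/andP => [[/orP[/dimvS h|//] dU]|[le dU]]; last first.
      by rewrite /comparable le orbT dU.
    by move: h dU; rewrite -!/(vdim _); lia.
  rewrite (eq_bigl _ _ selE) (level_mean phi hi selE').
  congr (_ * (_ - _)); rewrite /avg.
  have nt (U : G) : sub_level i (perp (val V)) (perp U) -> nontrivial U.
    by case/andP=> _ /eqP; rewrite dim_perp nontrivialP => dU; have := dim_le U; lia.
  rewrite -(sum_extend phi nt) (card_vertices nt).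
  rewrite [in RHS](reindex_inj (can_inj (@perpK F n))) /=; congr (_ / _%:R).
    by apply: eq_bigr => U _; rewrite perpK.
  rewrite -[LHS](card_imset _ (can_inj (@perpK F n))).
  apply: eq_card => U; rewrite -{1}(perpK U) mem_imset ?unfold_in ?perpK //.
  exact: (can_inj (@perpK F n)).
rewrite lower upper -mulrDr mulrAC divff // mul1r.
have -> : (n%:R : R) = (vdim V).-1%:R + (n - vdim V).-1%:R + 2%:R.
  by rewrite -!natrD; congr (_%:R); lia.
ring.
Qed.

End LaplacianFormula.

(** * From roots to eigenvectors *)

Section Eigenvectors.
Variables (F : finFieldType) (n : nat) (R : realType).
Notation G := {vspace 'rV[F]_n}.
Implicit Types (U V W : G) (k i j : nat) (phi : C0 F n R).
Notation q := (fieldq F R).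
Notation qi := (qint q).
Notation h := (level_prod q n).

Definition inv_sqrt_q : R := (Num.sqrt q)^-1.
Notation s := inv_sqrt_q.

Let q_gt0 : 0 < q. Proof. exact: lt_trans ltr01 (fieldq_gt1 F R). Qed.
Let q_neq0 : q != 0. Proof. by rewrite gt_eqF. Qed.

Let qi_neq0 m : (0 < m)%N -> qi m != 0.
Proof. by move=> m0; rewrite gt_eqF // qint_gt0 // fieldq_gt1. Qed.

Let s_pow m : s ^+ (2 * m) = (q ^+ m)^-1.
Proof. by rewrite exprM /s exprVn sqr_sqrtr ?exprVn // ltW. Qed.

Let one_minus_s m : 1 - s ^+ (2 * m) = (q - 1) * qi m / q ^+ m.
Proof.
have qm : q ^+ m != 0 by rewrite expf_neq0.
by rewrite s_pow qintE mulrBl divff // mul1r.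
Qed.

Let h_neq0 k : (0 < k <= n)%N -> h k != 0.
Proof. by move=> /andP[k0 kn]; rewrite /level_prod mulf_neq0 ?qi_neq0 // subn_gt0. Qed.

(** The identity behind it is
    [k+j] [n+1-k-j] = [k] [n+1-k] + q^k [j] [n+1-2k-j]. *)
Lemma eta_level_prod k j : (0 < k)%N -> (2 * k <= n)%N -> (j <= n.+1 - 2 * k)%N ->
  eta n k s j = h (k + j) / h k.
Proof.
move=> k0 kn jN.
have kn' : (0 < k <= n)%N by rewrite k0; lia.
have hk := h_neq0 kn'.
apply: (mulIf hk); rewrite divfK //.
have -> : h (k + j) = h k + (h (k + j) - h k) by ring.
rewrite level_prod_sub ?leq_addr //; last by lia.
rewrite /eta /ratio mulrDl mul1r; congr (_ + _).
rewrite !one_minus_s s_pow /level_prod.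
have -> : (k + j - k = j)%N by lia.
have -> : (n.+1 - k - (k + j) = n.+1 - 2 * k - j)%N by lia.
have -> : (n.+1 - k = k + (j + (n.+1 - 2 * k - j)))%N by lia.
set b := (n.+1 - 2 * k - j)%N.
have e1 : q - 1 != 0 by rewrite subr_eq0 gt_eqF // fieldq_gt1.
have e2 := qi_neq0 k0.
have e3 : qi (k + (j + b)) != 0 by rewrite qi_neq0 // addn_gt0 k0.
have e4 m : q ^+ m != 0 by rewrite expf_neq0.
move: (e4 k) (e4 j) (e4 b) e1 e2 e3; rewrite !exprD.
move: (q - 1) (q ^+ k) (q ^+ j) (q ^+ b) (qi k) (qi (k + (j + b))) (qi j) (qi b).
move=> r qk qj qb ik ikb ij ib *; field.
by do !(apply/andP; split).
Qed.

Lemma below_unique (f P : G -> R) :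
  (forall V, P V = (qi (\dim V))^-1 * Up (fun W => P W + f W) V) -> forall V, below f V = P V.
Proof.
move=> Prec V; have [d dE] := ubnP (\dim V).
elim: d V dE => // d IH V; rewrite ltnS => Vd.
rewrite below_rec Prec; congr (_ * _); apply: eq_bigr => W /andP[_ /eqP dW].
by rewrite IH // -dW.
Qed.

Lemma above_unique (f Q : G -> R) :
  (forall V, Q V = (qi (n - \dim V))^-1 * Down (fun W => Q W + f W) V) ->
  forall V, above f V = Q V.
Proof.
move=> Qrec V; have [d dE] := ubnP (n - \dim V).
elim: d V dE => // d IH V; rewrite ltnS => Vd.
rewrite above_rec Qrec; congr (_ * _); apply: eq_bigr => W /andP[_ /eqP dW].
by rewrite IH //; have := dim_le W; lia.
Qed.

Lemma leigenvalueP (L : 'End(C0 F n R)) (a : R) :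
  reflect (exists2 phi : C0 F n R, phi != 0 & L phi = a *: phi) (passmx.leigenvalue L a).
Proof.
rewrite /passmx.leigenvalue /passmx.leigenspace.
have memE phi : (phi \in lker (L - a *: \1%VF)) = (L phi == a *: phi).
  by rewrite memv_ker add_lfunE opp_lfunE scale_lfunE id_lfunE subr_eq0.
apply: (iffP idP) => [ker0|[phi phi0 Lphi]].
  exists (vpick (lker (L - a *: \1%VF))); first by rewrite vpick0.
  by apply/eqP; rewrite -memE memv_pick.
by apply: contra phi0 => /eqP K; rewrite -memv0 -K memE Lphi.
Qed.

Section RootToEigenvector.
Variables (k : nat) (w : R).
Hypotheses (k_gt0 : (0 < k)%N) (k_le : (2 * k <= n)%N).
Let N := (n.+1 - 2 * k)%N.
Let NE : N = (n.+1 - 2 * k)%N. Proof. by []. Qed.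

Let kn' : (0 < k <= n)%N. Proof. by rewrite k_gt0; lia. Qed.

Let eta_neq0 j : (0 < j < N)%N -> eta n k s j != 0.
Proof.
move=> /andP[j0 jN]; rewrite eta_level_prod ?(ltnW jN) //.
by rewrite mulf_neq0 ?invr_neq0 ?h_neq0 //; have := NE; lia.
Qed.

Let alpha j : R := if j == 0%N then 0 else (qi (k + j))^-1.
Let beta j : R := if j == N then 0 else (h (k + j) - h k) / qi (n.+1 - (k + j)).

Let edge_eta : eta n k s 0 = 1 /\ eta n k s N = 1.
Proof. by rewrite /eta ratio0 ratioN mulr0 addr0. Qed.

Let albe j : (j <= N)%N -> alpha j * beta j * eta n k s j = eta n k s j - 1.
Proof.
have [e0 eN] := edge_eta; rewrite /alpha /beta => jN.
case: eqVneq => [->|j0]; first by rewrite e0 subrr !mul0r.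
case: eqVneq => [->|jN']; first by rewrite eN subrr mulr0 mul0r.
rewrite eta_level_prod //; have hk := h_neq0 kn'.
have e1 : qi (k + j) != 0 by rewrite qi_neq0 // addn_gt0 k_gt0.
have e2 : qi (n.+1 - (k + j)) != 0 by rewrite qi_neq0 //; have := NE; lia.
have hE : h (k + j) = qi (k + j) * qi (n.+1 - (k + j)) by [].
rewrite {2}hE; move: e1 e2 hk.
move: (qi (k + j)) (qi (n.+1 - _)) (h k) hE => x y z -> *; field.
by do !(apply/andP; split).
Qed.

Let beta_neq0 j : (0 < j < N)%N -> beta j != 0.
Proof.
move=> /andP[j0 jN]; rewrite /beta ltn_eqF //.
rewrite mulf_neq0 ?invr_neq0 ?qi_neq0 //; last by have := NE; lia.
rewrite level_prod_sub ?leq_addr //; last by have := NE; lia.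
by rewrite !mulf_neq0 ?expf_neq0 ?qi_neq0 //; have := NE; lia.
Qed.

(** The eigenvector is x_j on level k+j of a string; y_j and z_j then give
    the averages over smaller and larger subspaces. *)
Lemma root_eigenvalue : w != 1 -> root (spectral_poly n k s) w ->
  passmx.leigenvalue (Laplacian0 F n R) (n%:R - 1 - (1 - w)^-1).
Proof.
move=> w1 rw; have N0 : (0 < N)%N by have := NE; lia.
have be0 : beta N = 0 by rewrite /beta eqxx.
have [x [y [z [sys x0]]]] :=
  block_system_exists (erefl : alpha 0 = 0) be0 albe eta_neq0 beta_neq0 N0 w1 rw.
have [g sg [V0 dV0 gV0]] := string_exists F R k_gt0 k_le.
have [g_low gU gD] := sg; have g_high := string_high sg.
pose f V := x (\dim V - k)%N * g V.
pose phi : C0 F n R := [ffun V : vertex F n => f (val V)].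
have nt V : g V != 0 -> (k <= \dim V <= n - k)%N.
  move=> gV; apply/andP; split; rewrite leqNgt; apply: contra gV => lt.
    by rewrite g_low.
  by rewrite g_high.
have extE V : extend phi V = f V.
  have [hV|hV] := boolP (0 < \dim V < n)%N.
    have nV : nontrivial V by rewrite nontrivialP.
    by rewrite /extend (insubT _ nV) /phi ffunE.
  rewrite extend0 // /f (_ : g V = 0) ?mulr0 //; apply/eqP.
  by apply: contraNT hV => /nt hh; have := k_gt0; lia.
have PE V : below (extend phi) V = y (\dim V - k)%N * g V.
  apply: (below_unique (P := fun V => y (\dim V - k)%N * g V)) => {}V.
  have [Vk|kV] := leqP (\dim V) k.
    have -> : Up (fun W => y (\dim W - k)%N * g W + extend phi W) V = 0.
      rewrite /Up big1 // => W /andP[_ /eqP dW]; rewrite extE /f g_low ?mulr0 ?addr0 //.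
      by rewrite -dW.
    rewrite mulr0; move: Vk; rewrite leq_eqVlt => /orP[/eqP e|/g_low->]; last by rewrite mulr0.
    by rewrite e subnn; have [-> _ _] := sys _ N0; rewrite /alpha mul0r mul0r.
  have -> : Up (fun W => y (\dim W - k)%N * g W + extend phi W) V =
      (y (\dim V - k).-1 + x (\dim V - k).-1) * g V.
    rewrite -[in RHS]gU // /Up mulr_sumr; apply: eq_bigr => W /andP[_ /eqP dW].
    by rewrite extE /f dW subSn 1?mulrDl // -ltnS -dW.
  have [->|/nt hV] := eqVneq (g V) 0; first by rewrite !mulr0.
  have jN : (\dim V - k < N)%N by have := NE; lia.
  have [-> _ _] := sys _ jN; rewrite /alpha -[_ == 0%N]negbK -lt0n subn_gt0 kV /=.
  by rewrite subnKC ?(ltnW kV) // mulrA.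
have QE V : above (extend phi) V = z (\dim V - k)%N * g V.
  apply: (above_unique (Q := fun V => z (\dim V - k)%N * g V)) => {}V.
  have [kV|Vk] := leqP k (\dim V); last first.
    rewrite g_low // mulr0; apply/esym/eqP; rewrite mulf_eq0; apply/orP; right; apply/eqP.
    have [e|ne] := eqVneq (\dim V).+1 k.
      transitivity ((z 0%N + x 0%N) * Down g V); last by rewrite gD // mulr0.
      rewrite /Down mulr_sumr; apply: eq_bigr => W /andP[_ /eqP dW].
      by rewrite extE /f dW e subnn mulrDl.
    rewrite /Down big1 // => W /andP[_ /eqP dW]; rewrite extE /f g_low ?mulr0 ?addr0 //.
    by rewrite dW ltn_neqAle ne.
  have -> : Down (fun W => z (\dim W - k)%N * g W + extend phi W) V =
      (z (\dim V - k).+1 + x (\dim V - k).+1) * ((h (\dim V).+1 - h k) * g V).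
    rewrite -(string_Down sg) // /Down mulr_sumr; apply: eq_bigr => W /andP[_ /eqP dW].
    by rewrite extE /f dW subSn // mulrDl.
  have [->|/nt hV] := eqVneq (g V) 0; first by rewrite !mulr0.
  have jN : (\dim V - k < N)%N by have := NE; lia.
  have [_ -> _] := sys _ jN; rewrite /beta -subSn // subnKC ?(leqW kV) // subSS.
  case: eqVneq => [e|_]; last by ring.
  have -> : (\dim V).+1 = (n.+1 - k)%N by have := NE; lia.
  by rewrite level_prod_sym ?subrr ?mul0r ?mulr0 //; lia.
apply/leigenvalueP; exists phi.
  have nV0 : nontrivial V0 by rewrite nontrivialP dV0; lia.
  apply: contra gV0 => /eqP/ffunP/(_ (Sub V0 nV0 : vertex F n)).
  by rewrite /phi !ffunE /f /= dV0 subnn x0 mul1r => ->.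
apply/ffunP => V; rewrite Laplacian_formula PE QE.
have -> : (n%:R - 1 - (1 - w)^-1) *: phi = [ffun V => (n%:R - 1 - (1 - w)^-1) * phi V].
  by apply/ffunP => U; rewrite !ffunE.
rewrite /phi !ffunE /f [in RHS]mulrBl; congr (_ - _).
have [->|/nt hV] := eqVneq (g (val V)) 0; first by rewrite !mulr0 !addr0.
have jN : (\dim (val V) - k < N)%N by have := NE; lia.
by have [_ _ e] := sys _ jN; rewrite mulrA -e; ring.
Qed.

End RootToEigenvector.

End Eigenvectors.

(** * From eigenvectors to roots *)

Section EigenvectorToRoot.
Variables (F : finFieldType) (n : nat) (R : realType).
Notation G := {vspace 'rV[F]_n}.
Implicit Types (U V W : G) (k i j : nat).
Notation q := (fieldq F R).
Notation qi := (qint q).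
Notation h := (level_prod q n).
Notation s := (inv_sqrt_q F R).

Let qi_neq0 m : (0 < m)%N -> qi m != 0.
Proof. by move=> m0; rewrite gt_eqF // qint_gt0 // fieldq_gt1. Qed.

Section Moments.
Variables (f g : G -> R) (k : nat).
Hypothesis sg : is_string k g.

(** The pairing with one level of the string.  Since U and D are adjoint,
    the recursions of below and above become scalar recursions for the
    moments. *)
Definition moment (p : G -> R) i : R := \sum_(V | \dim V == i) p V * g V.
Notation X := (moment f).
Notation Y := (moment (below f)).
Notation Z := (moment (above f)).

Let momentD p p' i : moment (fun V => p V + p' V) i = moment p i + moment p' i.
Proof. by rewrite /moment -big_split; apply: eq_bigr => V _; rewrite mulrDl. Qed.

Lemma moment_vanish p i : (forall V, \dim V = i -> g V = 0) -> moment p i = 0.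
Proof. by move=> g0; apply: big1 => V /eqP dV; rewrite g0 // mulr0. Qed.

Let below_moment i : Y i.+1 =
  (qi i.+1)^-1 * \sum_(W | \dim W == i) (below f W + f W) * Down g W.
Proof.
rewrite -(Up_Down_adjoint (fun W => below f W + f W)) mulr_sumr; apply: eq_bigr => V /eqP dV.
by rewrite below_rec dV mulrA.
Qed.

Lemma moment_below i : (k <= i)%N ->
  Y i.+1 = (h i.+1 - h k) / qi i.+1 * (Y i + X i).
Proof.
move=> ki; rewrite below_moment -momentD /moment mulr_sumr mulr_sumr.
apply: eq_bigr => W /eqP dW.
by rewrite (string_Down sg) dW //; ring.
Qed.

Lemma moment_below_base : Y k = 0.
Proof.
case: k sg => [|k'] [g0 gU gD].
  by apply: big1 => V /eqP dV; rewrite /below dV big_ord0 mul0r.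
by rewrite below_moment big1 ?mulr0 // => W /eqP dW; rewrite gD ?mulr0 // dW.
Qed.

Lemma moment_above i : (k <= i)%N -> Z i = (qi (n - i))^-1 * (Z i.+1 + X i.+1).
Proof.
move=> ki; rewrite -momentD /moment.
have [g0 gU gD] := sg.
transitivity ((qi (n - i))^-1 *
    \sum_(V | \dim V == i) g V * Down (fun W => above f W + f W) V).
  rewrite mulr_sumr; apply: eq_bigr => V /eqP dV; rewrite above_rec dV; ring.
rewrite -Up_Down_adjoint; congr (_ * _); apply: eq_bigr => V /eqP dV.
by rewrite mulrC gU // dV.
Qed.

Variable mu : R.
Hypothesis mu_neq0 : mu != 0.
Hypothesis f_eig : forall V, (0 < \dim V < n)%N -> below f V + f V + above f V = mu * f V.

Lemma moment_eig i : (0 < i < n)%N -> Y i + X i + Z i = mu * X i.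
Proof.
move=> hi; rewrite -!momentD /moment mulr_sumr; apply: eq_bigr => V /eqP dV.
by rewrite f_eig ?dV // mulrA.
Qed.

(** The moments of an eigenvector solve a block system with the same products
    al_j be_j as in root_eigenvalue, transposed. *)
Lemma moment_eq0_pos : (0 < k)%N -> (2 * k <= n)%N ->
  ~~ root (spectral_poly n k s) (1 - mu^-1) -> forall i, X i = 0.
Proof.
move=> k0 kn nroot i; have [g_low gU gD] := sg; have g_high := string_high sg.
have [ik|ki] := ltnP i k; first by apply: moment_vanish => V dV; apply: g_low; rewrite dV.
have [ki'|ik'] := ltnP (n - k) i.
  by apply: moment_vanish => V dV; apply: g_high; rewrite dV.
pose N := (n.+1 - 2 * k)%N.
have NE : N = (n.+1 - 2 * k)%N by [].
have N0 : (0 < N)%N by lia.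
have kn' : (0 < k <= n)%N by lia.
have h_neq0 m : (0 < m <= n)%N -> h m != 0.
  by move=> /andP[m0 mn]; rewrite /level_prod mulf_neq0 ?qi_neq0 // subn_gt0.
pose al j : R := if j == 0%N then 0 else (h (k + j) - h k) / qi (k + j).
pose be j : R := if j == N then 0 else (qi (n.+1 - (k + j)))^-1.
have e0 : eta n k s 0 = 1 by rewrite /eta ratio0 mulr0 addr0.
have eN : eta n k s N = 1 by rewrite /eta ratioN mulr0 addr0.
have albe j : (j <= N)%N -> al j * be j * eta n k s j = eta n k s j - 1.
  rewrite /al /be => jN; case: eqVneq => [->|j0]; first by rewrite e0 subrr !mul0r.
  case: eqVneq => [->|jN']; first by rewrite eN subrr mulr0 mul0r.
  rewrite eta_level_prod //; have hk := h_neq0 _ kn'.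
  have e1 : qi (k + j) != 0 by rewrite qi_neq0 // addn_gt0 k0.
  have e2 : qi (n.+1 - (k + j)) != 0 by rewrite qi_neq0 //; lia.
  have hE : h (k + j) = qi (k + j) * qi (n.+1 - (k + j)) by [].
  move: e1 e2 hk hE.
  move: (qi (k + j)) (qi (n.+1 - _)) (h k) (h (k + j)) => x y z t e1 e2 e3 ->; field.
  by do !(apply/andP; split).
have eta_neq0 j : (0 < j < N)%N -> eta n k s j != 0.
  move=> /andP[j0 jN]; rewrite eta_level_prod ?(ltnW jN) //.
  by rewrite mulf_neq0 ?invr_neq0 ?h_neq0 //; lia.
have be_neq0 j : (0 < j < N)%N -> be j != 0.
  move=> /andP[j0 jN]; rewrite /be ltn_eqF // invr_neq0 // qi_neq0 //; lia.
have sys : block_system N al be mu (fun j => X (k + j)) (fun j => Y (k + j)) (fun j => Z (k + j)).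
  move=> j jN; split; last by apply: moment_eig; lia.
    case: j jN => [|j] jN; first by rewrite addn0 moment_below_base /al mul0r.
    by rewrite addnS moment_below ?leq_addr // /al /= addnS.
  rewrite moment_above ?leq_addr // -addnS /be.
  case: eqVneq => [e|_]; last by rewrite addrC addnS subSS.
  rewrite !moment_vanish ?addr0 ?mulr0 // => V dV; apply: g_high; rewrite dV; lia.
have be0 : be N = 0 by rewrite /be eqxx.
have jN : (i - k < N)%N by lia.
have := block_system_root (erefl : al 0%N = 0) be0 albe eta_neq0 be_neq0 mu_neq0 sys nroot jN.
by rewrite subnKC.
Qed.

(** Here all the products al_j be_j are 1 and the matrix has rank 1: the
    three moments add up to the same constant in every dimension, after
    normalization by c, so that mu is 0 or n-1. *)
Lemma moment_eq0_const : k = 0%N -> (forall V, ~~ (0 < \dim V < n)%N -> f V = 0) ->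
  mu != n%:R - 1 -> forall i, X i = 0.
Proof.
move=> k0 f0 mun.
have X_out i : ~~ (0 < i < n)%N -> X i = 0.
  by move=> hi; apply: big1 => V /eqP dV; rewrite f0 ?mul0r // dV.
have Y0 : Y 0%N = 0 by have := moment_below_base; rewrite k0.
have YS i : (i < n)%N -> Y i.+1 = qi (n - i) * (Y i + X i).
  move=> lt; rewrite moment_below ?k0 // /level_prod qint0 mul0r subr0 subSS.
  by rewrite [qi i.+1 * _]mulrC mulfK // qi_neq0.
have ZS i : (i < n)%N -> qi (n - i) * Z i = Z i.+1 + X i.+1.
  by move=> lt; rewrite moment_above ?k0 // mulVKf // qi_neq0 // subn_gt0.
have Zn : Z n = 0.
  apply: big1 => V /eqP dV.
  by rewrite /above /below dim_perp dV subnn big_ord0 mul0r.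
pose S i := Y i + X i + Z i.
have SS i : (i < n)%N -> S i.+1 = qi (n - i) * S i.
  by move=> lt; rewrite /S mulrDr ZS // -YS //; ring.
pose c i : R := \prod_(l < i) qi (n - l).
have cS i : c i.+1 = c i * qi (n - i) by rewrite /c big_ord_recr.
have c_neq0 i : (i <= n)%N -> c i != 0.
  move=> le; apply/prodf_neq0 => l _; apply: qi_neq0; rewrite subn_gt0.
  exact: leq_trans (ltn_ord l) le.
have SE i : (i <= n)%N -> S i = c i * S 0%N.
  elim: i => [|i IH] lt; first by rewrite /c big_ord0 mul1r.
  by rewrite SS // IH ?(ltnW lt) // cS; ring.
have muX i : (0 < i < n)%N -> mu * X i = c i * S 0%N.
  by move=> hi; rewrite -moment_eig // -SE //; case/andP: hi => _ /ltnW.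
have YE i : (i < n)%N -> mu * Y i.+1 = c i.+1 * (i%:R * S 0%N).
  elim: i => [|i IH] lt; first by rewrite YS // Y0 X_out // addr0 !mulr0 mul0r mulr0.
  rewrite YS // mulrCA mulrDr IH ?(ltnW lt) // muX ?lt // [c i.+2]cS -[i.+1%:R]natr1.
  ring.
case: (posnP n) => [n0|n0] i; first by apply: X_out; rewrite n0 ltn0 andbF.
have S0 : S 0%N = 0.
  have Sn : S n = Y n by rewrite /S Zn X_out ?ltnn ?andbF // !addr0.
  have := YE n.-1; rewrite prednK // leqnn => /(_ isT).
  rewrite -Sn SE // => e.
  have : c n * ((mu - (n%:R - 1)) * S 0%N) = 0.
    have -> : (n%:R : R) - 1 = n.-1%:R by rewrite -[in LHS](prednK n0) -natr1 addrK.
    by rewrite mulrBl mulrBr -e; ring.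
  move/eqP; rewrite !mulf_eq0 (negPf (c_neq0 _ (leqnn n))) subr_eq0 (negPf mun) /=.
  by move/eqP.
have [hi|/X_out//] := boolP (0 < i < n)%N.
by apply: (mulfI mu_neq0); rewrite muX // S0 !mulr0.
Qed.

End Moments.

(** An eigenvector has a nonzero moment against some string. *)
Lemma eigenvalue_root (a : R) : passmx.leigenvalue (Laplacian0 F n R) a ->
  a != 0 -> a != n%:R - 1 ->
  exists2 k, (0 < k <= n./2)%N & root (spectral_poly n k s) (1 - (n%:R - 1 - a)^-1).
Proof.
move=> /leigenvalueP[phi phi0 Lphi] a0 an; set mu := n%:R - 1 - a.
have mu0 : mu != 0 by rewrite subr_eq0 eq_sym.
have mun : mu != n%:R - 1 by rewrite /mu -subr_eq0 addrAC subrr add0r oppr_eq0.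
have [|none] := boolP [exists k : 'I_(n./2), root (spectral_poly n k.+1 s) (1 - mu^-1)].
  by case/existsP => k rk; exists k.+1; rewrite ?ltn_ord.
have f_eig V : (0 < \dim V < n)%N ->
    below (extend phi) V + extend phi V + above (extend phi) V = mu * extend phi V.
  rewrite -nontrivialP => nV; pose v : vertex F n := Sub V nV.
  have := congr1 (fun p : C0 F n R => p v) Lphi; rewrite Laplacian_formula ffunE /= => e.
  have <- : phi v = extend phi V by rewrite -extendE.
  rewrite /mu mulrBl -[a * _]e; ring.
case/eqP: phi0; apply/ffunP => v; rewrite ffunE -extendE.
apply: (strings_span (i := \dim (val v))) => // k g sg.
have [k0|k0] := posnP k.
  by apply: (moment_eq0_const sg mu0 f_eig k0 _ mun) => V; apply: extend0.
have [kn|kn] := leqP (2 * k) n; last first.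
  by apply: big1 => V _; rewrite (string_big sg kn) mulr0.
apply: (moment_eq0_pos sg mu0 f_eig k0 kn).
have kn2 : (k.-1 < n./2)%N by lia.
move: none; rewrite negb_exists => /forallP/(_ (Ordinal kn2)).
by rewrite /= prednK.
Qed.

Lemma eigenvalue_0 : (2 <= n)%N -> passmx.leigenvalue (Laplacian0 F n R) 0.
Proof.
move=> n2; apply/leigenvalueP; exists [ffun=> 1].
  have [U /andP[_ /eqP dU]] := @sub_level_exists F n 1 fullv
    (eq_ind_r (leq 1) (ltnW n2) (dim_fullv F n)).
  have nU : nontrivial U by rewrite nontrivialP dU n2.
  by apply/eqP => /ffunP/(_ (Sub U nU : vertex F n)); rewrite !ffunE => /eqP; rewrite oner_eq0.
rewrite scale0r Laplacian0E.
have -> : d0 [ffun=> 1] = 0 :> C1 F n R.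
  by apply: val_inj; apply/ffunP => e; rewrite !ffunE subrr.
exact: linear0.
Qed.

Lemma sum_indicator m l : \sum_(i < m) ((i == l :> nat)%:R : R) = (l < m)%N%:R.
Proof.
have [lm|ml] := ltnP l m.
  rewrite (bigD1 (Ordinal lm)) //= eqxx big1 ?addr0 // => i il.
  by rewrite (_ : _ == _ = false) //; apply: contraNF il => /eqP e; apply/eqP/val_inj.
by apply: big1 => i _; rewrite ltn_eqF // (leq_trans _ ml).
Qed.

(** A function of the dimension only, with sum 0 over the dimensions. *)
Lemma eigenvalue_top : (3 <= n)%N -> passmx.leigenvalue (Laplacian0 F n R) (n%:R - 1).
Proof.
move=> n3; pose c d : R := (d == 1%N)%:R - (d == 2%N)%:R.
pose phi : C0 F n R := [ffun V : vertex F n => c (\dim (val V))].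
have extE V : extend phi V = c (\dim V).
  have [hV|hV] := boolP (0 < \dim V < n)%N.
    have nV : nontrivial V by rewrite nontrivialP.
    by rewrite /extend (insubT _ nV) /phi ffunE.
  rewrite extend0 // /c; have dn := dim_le V.
  have -> : (\dim V == 1%N) = false by lia.
  have -> : (\dim V == 2%N) = false by lia.
  by rewrite subrr.
have avgE f (b : nat -> R) i V : (i <= \dim V)%N -> (forall U, f U = b (\dim U)) ->
    avg i f V = b i.
  move=> iV fb; have [U0 hU0] := sub_level_exists iV.
  have c0 : (#|sub_level i V|%:R : R) != 0.
    by rewrite pnatr_eq0 -lt0n; apply/card_gt0P; exists U0.
  rewrite /avg (eq_bigr (fun=> b i)) => [|U /andP[_ /eqP dU]]; last by rewrite fb dU.
  by rewrite sumr_const -[_ *+ _]mulr_natl mulrAC divff // mul1r.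
have belowE f (b : nat -> R) V : (forall U, f U = b (\dim U)) ->
    below f V = \sum_(i < \dim V) b i.
  by move=> fb; apply: eq_bigr => i _; apply: avgE (ltnW (ltn_ord i)) fb.
apply/leigenvalueP; exists phi.
  have [U /andP[_ /eqP dU]] := @sub_level_exists F n 1 fullv
    (eq_ind_r (leq 1) (ltnW (ltnW n3)) (dim_fullv F n)).
  have nU : nontrivial U by rewrite nontrivialP dU; lia.
  apply/eqP => /ffunP/(_ (Sub U nU : vertex F n)); rewrite /phi !ffunE /= dU /c /= subr0 => /eqP.
  by rewrite oner_eq0.
apply/ffunP => V; rewrite Laplacian_formula /above.
have -> : ((n%:R - 1) *: phi) V = (n%:R - 1) * phi V by rewrite [LHS]ffunE.
rewrite (belowE _ c) // (belowE _ (fun i => c (n - i)%N)) => [|U]; last first.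
  by rewrite /= extE dim_perp.
rewrite dim_perp (_ : phi V = c (\dim (val V))) ?ffunE //.
have := vdim_gt0 V; have := vdim_lt V; rewrite /vdim.
move: (\dim (val V)) => d dn d0.
have -> : \sum_(i < n - d) c (n - i)%N =
    \sum_(i < n - d) ((i == (n - 1)%N :> nat)%:R - (i == (n - 2)%N :> nat)%:R).
  apply: eq_bigr => i _; have := ltn_ord i; move: (nat_of_ord i) => {}i lt.
  by congr ((nat_of_bool _)%:R - (nat_of_bool _)%:R); lia.
rewrite /c !sumrB !sum_indicator.
have -> : (n - 1 < n - d)%N = false by lia.
have -> : (n - 2 < n - d)%N = (d == 1%N) by lia.
have -> : (1 < d)%N = (d != 1%N) by lia.
have -> : (2 < d)%N = (d != 1%N) && (d != 2%N) by lia.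
case: eqVneq => [->|_] /=; first by ring.
by case: eqVneq => _ /=; ring.
Qed.

End EigenvectorToRoot.

(** * The spectrum over large fields *)

Section LargeFields.
Variables (R : realType).

Definition for_large_fields (P : finFieldType -> Prop) :=
  exists q0 : nat, forall F : finFieldType, (q0 <= #|F|)%N -> P F.

Lemma for_large_fieldsI (P Q : finFieldType -> Prop) :
  for_large_fields P -> for_large_fields Q -> for_large_fields (fun F => P F /\ Q F).
Proof.
move=> [p hP] [q hQ]; exists (maxn p q) => F; rewrite geq_max => /andP[pF qF].
by split; [apply: hP|apply: hQ].
Qed.

Lemma for_large_fields_lt m (P : nat -> finFieldType -> Prop) :
  (forall k, (k < m)%N -> for_large_fields (P k)) ->
  for_large_fields (fun F => forall k, (k < m)%N -> P k F).
Proof.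
elim: m => [|m IH] h; first by exists 0%N.
have [q1 h1] := for_large_fieldsI (IH (fun k lt => h k (ltnW lt))) (h m (ltnSn m)).
exists q1 => F /h1[hk hm] k; rewrite ltnS leq_eqVlt => /orP[/eqP->//|].
exact: hk.
Qed.

Lemma for_large_fields_imp (P Q : finFieldType -> Prop) :
  (forall F, P F -> Q F) -> for_large_fields P -> for_large_fields Q.
Proof. by move=> PQ [q0 h]; exists q0 => F /h/PQ. Qed.

Lemma large_fields_inv_sqrt (s0 : R) : 0 < s0 ->
  for_large_fields (fun F => 0 < inv_sqrt_q F R <= s0).
Proof.
move=> s0_gt0; exists (Num.bound (s0 ^- 2)) => F hF.
have qF : 0 < fieldq F R by apply: lt_trans ltr01 (fieldq_gt1 F R).
have sq : 0 < Num.sqrt (fieldq F R) by rewrite sqrtr_gt0.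
rewrite invr_gt0 sq /= -[leRHS]invrK lef_pV2 ?posrE ?invr_gt0 //.
rewrite -[leLHS]ger0_norm ?invr_ge0 ?(ltW s0_gt0) // -sqrtr_sqr; apply: ler_wsqrtr; rewrite exprVn.
apply/ltW/(lt_le_trans (archi_boundP _)); last by rewrite ler_nat.
by rewrite invr_ge0 exprn_ge0 // ltW.
Qed.

Variables (n : nat).

Lemma large_fields_root_small (eps : R) : 0 < eps ->
  for_large_fields (fun F => forall k w, (0 < k <= n./2)%N ->
    root (spectral_poly n k (inv_sqrt_q F R)) w -> `|w| <= eps).
Proof.
move=> e0.
apply: (for_large_fields_imp (P := fun F => forall k, (k < n./2)%N ->
  forall w, root (spectral_poly n k.+1 (inv_sqrt_q F R)) w -> `|w| <= eps)).
  by move=> F h [//|k] w /= hk; apply: h.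
apply: for_large_fields_lt => k kn.
have [C C0 hC] := @block_root_small R n k.+1 isT ltac:(lia).
have d0 : 0 < Num.min (1 / 2) (eps / (C + 1)).
  have C1 : 0 < C + 1 by lra.
  by rewrite lt_min; apply/andP; split; [lra | rewrite divr_gt0].
apply: for_large_fields_imp (large_fields_inv_sqrt d0) => F /andP[s0].
rewrite le_min => /andP[s1 s2] w rw.
have hs : 0 < inv_sqrt_q F R <= 1 / 2 by rewrite s0 s1.
apply: le_trans (hC _ _ hs rw) _; move: s2.
rewrite ler_pdivlMr ?ltr_wpDl // => s2.
by apply: le_trans s2; rewrite mulrC ler_wpM2l ?(ltW s0) //; lra.
Qed.

Lemma large_fields_roots_disjoint :
  for_large_fields (fun F => forall k k' w, (0 < k)%N -> (k < k' <= n./2)%N ->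
    root (spectral_poly n k (inv_sqrt_q F R)) w -> ~~ root (spectral_poly n k' (inv_sqrt_q F R)) w).
Proof.
apply: (for_large_fields_imp (P := fun F => forall k', (k' < n./2.+1)%N ->
  forall k, (k < k')%N -> (0 < k)%N -> forall w,
  root (spectral_poly n k (inv_sqrt_q F R)) w -> ~~ root (spectral_poly n k' (inv_sqrt_q F R)) w)).
  by move=> F h k k' w k0 /andP[kk' k'n]; apply: h.
apply: for_large_fields_lt => k' k'n; apply: for_large_fields_lt => k kk'.
have [->|k0] := posnP k; first by exists 0%N.
have [s0 s0_gt0 h] := @block_roots_disjoint R n k k' k0 kk' ltac:(lia).
apply: for_large_fields_imp (large_fields_inv_sqrt s0_gt0) => F hs _ w.
exact: h.
Qed.

End LargeFields.

(** Induction in steps of 2: passing from n to n+2 adds a block of size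
    n+1. *)
Lemma block_sizes_sum n : (\sum_(i < n./2) (n.+1 - 2 * i.+1) = n ^ 2 %/ 4)%N.
Proof.
suff [] : (\sum_(i < n./2) (n.+1 - 2 * i.+1) = n ^ 2 %/ 4)%N /\
  (\sum_(i < n.+1./2) (n.+2 - 2 * i.+1) = n.+1 ^ 2 %/ 4)%N by [].
elim: n => [|n [IH0 IH1]]; first by rewrite /= !big_ord0.
split=> //; rewrite [in LHS]/= big_ord_recl.
have -> : (n.+2 ^ 2 %/ 4 = n.+1 + n ^ 2 %/ 4)%N.
  have -> : (n.+2 ^ 2 = n.+1 * 4 + n ^ 2)%N by rewrite -!mulnn; lia.
  by rewrite divnMDl.
rewrite -IH0; congr (_ + _)%N.
by apply: eq_bigr => i _; rewrite lift0; lia.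
Qed.

Lemma block_real_roots (R : realType) n k (s : R) : 0 < s <= 1 / 2 ->
  (0 < k)%N -> (2 * k <= n)%N ->
  exists r : seq R, [/\ uniq r, size r = (n.+1 - 2 * k)%N
    & forall w, root (spectral_poly n k s) w = (w \in r)].
Proof.
move=> hs k0 kn; apply: jac_real_roots => j hj.
have r0 := ratio_gt0 hs k0 kn hj; have /andP[s0 _] := hs.
have t0 : 0 < s ^+ (2 * k) * ratio n k s j by rewrite mulr_gt0 ?exprn_gt0.
by rewrite /eta mulr_gt0 //; lra.
Qed.

Theorem corollary1p6 (R : realType) (n : nat) (n_ge3 : (3 <= n)%N) :
  (exists q0 : nat, forall F : finFieldType, (q0 <= #|F|)%N ->
     exists s : seq R,
       [/\ uniq s,
           (forall a : R, (a \in s) = passmx.leigenvalue (Laplacian0 F n R) a)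
         & size s = (n ^ 2 %/ 4 + 2)%N])
  /\
  (forall eps : R, 0 < eps ->
     exists q0 : nat, forall F : finFieldType, (q0 <= #|F|)%N ->
       forall a : R, passmx.leigenvalue (Laplacian0 F n R) a ->
         a != 0 -> a != n%:R - 1 -> `|a - (n%:R - 2)| < eps).
Proof.
pose ev (w : R) : R := n%:R - 1 - (1 - w)^-1.
have ev_inv a : a != n%:R - 1 -> ev (1 - (n%:R - 1 - a)^-1) = a.
  by move=> an; rewrite /ev subKr invrK subKr.
have n3 : (3 : R) <= n%:R by rewrite (ler_nat R 3).
have inv_bound (w : R) : `|w| <= 1 / 4 -> 4 / 5 <= (1 - w)^-1 <= 4 / 3.
  rewrite ler_norml => /andP[w1 w2]; have d0 : 0 < 1 - w by lra.
  by rewrite -(ler_pM2l d0) -[X in _ && X](ler_pM2l d0) divff ?gt_eqF //;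
    apply/andP; split; lra.
split.
  have q4 : 0 < 1 / 4 :> R by lra.
  have q2 : 0 < 1 / 2 :> R by lra.
  have large := for_large_fieldsI (large_fields_inv_sqrt q2)
    (for_large_fieldsI (large_fields_root_small n q4) (large_fields_roots_disjoint R n)).
  apply: for_large_fields_imp large => F [hs [small disj]].
  set s := inv_sqrt_q F R in hs small disj.
  have /fin_all_exists[r rP] (i : 'I_(n./2)) : exists r : seq R,
      [/\ uniq r, size r = (n.+1 - 2 * i.+1)%N
         & forall w, root (spectral_poly n i.+1 s) w = (w \in r)].
    by apply: block_real_roots => //; have := ltn_ord i; lia.
  have r_small (i : 'I_(n./2)) w : w \in r i -> `|w| <= 1 / 4.
    have [_ _ <-] := rP i; apply: small; exact: ltn_ord.
  have r_inv (i : 'I_(n./2)) w : w \in r i -> 4 / 5 <= (1 - w)^-1 <= 4 / 3.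
    by move=> /r_small/inv_bound.
  pose evs := [seq ev w | i <- enum 'I_(n./2), w <- r i].
  have evsP a : reflect (exists2 i : 'I_(n./2), true & exists2 w, w \in r i & a = ev w) (a \in evs).
    apply: (iffP allpairsPdep) => [[i [w [_ wi ->]]]|[i _ [w wi ->]]].
      by exists i => //; exists w.
    by exists i, w; rewrite mem_enum.
  have evs_range a : a \in evs -> 0 < a < n%:R - 1.
    by case/evsP => i _ [w /r_inv/andP[h1 h2] ->]; rewrite /ev; apply/andP; split; lra.
  exists (0 :: (n%:R - 1) :: evs); split.
  - rewrite /= inE negb_or; apply/and3P; split.
    + apply/andP; split; first by rewrite eq_sym gt_eqF //; lra.
      by apply/negP => /evs_range; rewrite ltxx.
    + by apply/negP => /evs_range; rewrite ltxx andbF.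
    apply: allpairs_uniq_dep; first exact: enum_uniq.
      by move=> i _; case: (rP i).
    move=> _ _ /allpairsPdep[i [w [_ wi ->]]] /allpairsPdep[i' [w' [_ wi' ->]]] /= E.
    have ww' : w = w' by apply: oppr_inj; apply: (addrI 1); apply: invr_inj;
      apply: oppr_inj; apply: (addrI (n%:R - 1)).
    rewrite -{w'}ww' in wi' E *; suff -> : i = i' by [].
    have root_of (l : 'I_(n./2)) : w \in r l -> root (spectral_poly n l.+1 s) w.
      by have [_ _ <-] := rP l.
    have no_lt (l l' : 'I_(n./2)) : w \in r l -> w \in r l' -> ~~ (l < l')%N.
      move=> wl wl'; apply/negP => ll'; have /negP := disj l.+1 l'.+1 w isT (ltac:(
        by rewrite ltnS ll' ltn_ord)) (root_of _ wl).
      by apply; apply: root_of.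
    by apply/val_inj/eqP; rewrite eqn_leq leqNgt no_lt //= leqNgt no_lt.
  - move=> a; rewrite !inE; apply/idP/idP.
      case/or3P => [/eqP->|/eqP->|/evsP[i _ [w wi ->]]].
      + by apply: eigenvalue_0; apply: ltnW.
      + exact: eigenvalue_top.
      have i2 : (2 * i.+1 <= n)%N by have := ltn_ord i; lia.
      apply: (root_eigenvalue (ltn0Sn i) i2).
        have := r_small _ _ wi; rewrite ler_norml => /andP[_ w1].
        by rewrite lt_eqF //; lra.
      by have [_ _ ->] := rP i.
    move=> ea; have [//|a0] := eqVneq a 0; have [//|an] := eqVneq a (n%:R - 1).
    have [k /andP[k0 kn] rk] := eigenvalue_root ea a0 an.
    have kn' : (k.-1 < n./2)%N by rewrite prednK.
    apply/evsP; exists (Ordinal kn') => //; exists (1 - (n%:R - 1 - a)^-1).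
      by have [_ _ <-] := rP (Ordinal kn'); rewrite /= prednK.
    by rewrite ev_inv.
  rewrite /= size_allpairs_dep sumnE big_map big_enum /=.
  rewrite (eq_bigr (fun i : 'I_(n./2) => (n.+1 - 2 * i.+1)%N)) => [|i _]; last by case: (rP i).
  by rewrite block_sizes_sum addn2.
move=> eps e0; pose d := Num.min (1 / 4) (eps / 2).
have d0 : 0 < d by rewrite lt_min; apply/andP; split; lra.
apply: for_large_fields_imp (large_fields_root_small n d0) => F small a ea a0 an.
have [k kn rk] := eigenvalue_root ea a0 an.
have := small _ _ kn rk; set w := 1 - _; rewrite le_min => /andP[/inv_bound/andP[h1 h2] w2].
have -> : a - (n%:R - 2) = - w * (1 - w)^-1.
  rewrite -(ev_inv a an) -/w /ev; have : 1 - w != 0.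
    by apply: contraTneq h1 => ->; rewrite invr0; lra.
  by move=> w1; field.
rewrite normrM normrN [X in _ * X]ger0_norm; last by lra.
have := normr_ge0 w; nra.
Qed.
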